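(* Let $s>\tfrac12$ be real. The functions $\Phi_k^{(s)}$, $k\in\mathbb{Z}$, are complete and orthonormal in $L^2\big(\mathbb{R},\mathbb{C};w_x^{(s,0)}\big)$ with $w_x^{(s,0)}(x)=2^s/(1+x^2)^s$. The functions $\phi_k^{(s)}$, $k\in\mathbb{Z}$, are complete and orthonormal in $L^2(\mathbb{R},\mathbb{C})$ (unit weight). Furthermore, for every $k\in\mathbb{Z}$, $$\lim_{|x|\to\infty}\big|x^t\,\phi_k^{(s)}(x)\big|<\infty,\qquad t\le s.$$
   Context: For $\alpha,\beta>-1$ and $n\in\mathbb{N}_0=\{0,1,2,\dots\}$, $\tilde P_n^{(\alpha,\beta)}$ is the classical Jacobi polynomial $P_n^{(\alpha,\beta)}$ divided by its norm in $L^2([-1,1];(1-r)^\alpha(1+r)^\beta)$. For $s>\tfrac12$, $k\in\mathbb{Z}$ and $x\in\mathbb{R}$ define $$\Phi_k^{(s)}(x)=\begin{cases}\dfrac1{\sqrt2}\tilde P_0^{(-1/2,s-3/2)}\Big(\dfrac{1-x^2}{1+x^2}\Big), & k=0,\\[2mm] \dfrac12\Big[\tilde P_{|k|}^{(-1/2,s-3/2)}\Big(\dfrac{1-x^2}{1+x^2}\Big)+\dfrac{2ix\,\mathrm{sgn}(k)}{x^2+1}\tilde P_{|k|-1}^{(1/2,s-1/2)}\Big(\dfrac{1-x^2}{1+x^2}\Big)\Big], & k\ne0,\end{cases}$$ and the generalized Wiener rational functions $$\phi_k^{(s)}(x)=\frac{2^{s/2}}{(x-i)^s}\,\Phi_k^{(s)}(x),$$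 where $(x-i)^{-s}=(1+x^2)^{-s/2}\exp\big[\tfrac{is}{2}(\pi-2\arctan x)\big]$ (principal branch). $L^2(\mathbb{R},\mathbb{C};w)$ carries the inner product $\langle f,g\rangle_w=\int_{\mathbb{R}}f\,\overline g\,w\,dx$. ''Complete'' means that the finite linear span is dense. *)

(* Defs.v *)
From HB Require Import structures.
From mathcomp Require Import all_boot all_order all_algebra.
From mathcomp Require Import complex.
From mathcomp Require Import all_classical all_reals all_analysis.

Set Implicit Arguments.
Unset Strict Implicit.
Unset Printing Implicit Defensive.

Import Order.TTheory GRing.Theory Num.Theory numFieldNormedType.Exports.
Import Normc.

Local Open Scope classical_set_scope.
Local Open Scope ring_scope.
Local Open Scope complex_scope.

Definition expi (R : realType) (theta : R) : R[i] := cos theta +i* sin theta.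

(* Principal branch of x^t for real x and t. *)
Definition real_cpow (R : realType) (x t : R) : R[i] :=
  (`|x| `^ t)%:C * expi (if x < 0 then pi * t else 0).

(* a (a - 1) ... (a - j + 1) / j!, the binomial coefficient with real top. *)
Definition gbinom (R : realType) (a : R) (j : nat) : R :=
  (\prod_(i < j) (a - i%:R)) / j`!%:R.

(* Szego's normalization, with value gbinom (n + alpha) n at 1. *)
Definition jacobi (R : realType) (alpha beta : R) (n : nat) : {poly R} :=
  \sum_(j < n.+1)
    (gbinom (n%:R + alpha) (n - j) * gbinom (n%:R + beta) j) *:
      ((2^-1 *: ('X - 1)) ^+ j * (2^-1 *: ('X + 1)) ^+ (n - j)).

Definition jacobi_norm (R : realType) (alpha beta : R) (n : nat) : R :=
  Num.sqrt (\int[lebesgue_measure]_(r in `[(-1 : R), 1])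
    ((jacobi alpha beta n).[r] ^+ 2 * ((1 - r) `^ alpha * (1 + r) `^ beta))).

Definition njacobi (R : realType) (alpha beta : R) (n : nat) (r : R) : R :=
  (jacobi alpha beta n).[r] / jacobi_norm alpha beta n.

Definition Phi (R : realType) (s : R) (k : int) (x : R) : R[i] :=
  let r := (1 - x ^+ 2) / (1 + x ^+ 2) in
  if k == 0 then ((Num.sqrt 2)^-1 * njacobi (- 2^-1) (s - 3 / 2) 0 r)%:C
  else (2^-1)%:C *
    ((njacobi (- 2^-1) (s - 3 / 2) `|k|%N r)%:C
     + 'i%C * (2 * x * (sgz k)%:~R / (x ^+ 2 + 1)
             * njacobi 2^-1 (s - 2^-1) `|k|%N.-1 r)%:C).

(* (x - i)^(-s), principal branch: arg (x - i) = atan x - pi / 2. *)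
Definition xmi_powN (R : realType) (s x : R) : R[i] :=
  ((1 + x ^+ 2) `^ (- (s / 2)))%:C * expi (s / 2 * (pi - 2 * atan x)).

Definition phi (R : realType) (s : R) (k : int) (x : R) : R[i] :=
  (2 `^ (s / 2))%:C * xmi_powN s x * Phi s k x.

Definition wx (R : realType) (s x : R) : R := 2 `^ s / (1 + x ^+ 2) `^ s.

(* The weighted space L^2(R, C; w), through representatives. *)

Definition cmeasurable (R : realType) (f : R -> R[i]) : Prop :=
  measurable_fun setT (fun x => complex.Re (f x)) /\
  measurable_fun setT (fun x => complex.Im (f x)).

(* Extended-real valued: +oo when f is not square integrable. *)
Definition L2norm (R : realType) (w : R -> R) (f : R -> R[i]) : \bar R :=
  sqrte (\int[lebesgue_measure]_x (normc (f x) ^+ 2 * w x)%R%:E)%E.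

Definition in_L2 (R : realType) (w : R -> R) (f : R -> R[i]) : Prop :=
  cmeasurable f /\ (L2norm w f < +oo)%E.

Definition inner (R : realType) (w : R -> R) (f g : R -> R[i]) : R[i] :=
  (\int[lebesgue_measure]_x (complex.Re (f x * (g x)^*%C) * w x))
  +i* (\int[lebesgue_measure]_x (complex.Im (f x * (g x)^*%C) * w x)).

Definition orthonormal_L2 (R : realType) (w : R -> R)
    (F : int -> R -> R[i]) : Prop :=
  (forall k, in_L2 w (F k)) /\
  (forall j k, inner w (F j) (F k) = (j == k)%:R).

Definition complete_L2 (R : realType) (w : R -> R)
    (F : int -> R -> R[i]) : Prop :=
  (forall k, in_L2 w (F k)) /\
  forall f, in_L2 w f -> forall e : R, 0 < e ->
    exists (K : seq int) (c : int -> R[i]),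
      (L2norm w (fun x => f x - \sum_(k <- K) c k * F k x)%R < e%:E)%E.

(* Main.v *)
Require Import Defs.
From HB Require Import structures.
From mathcomp Require Import all_boot all_order all_algebra.
From mathcomp Require Import complex.
From mathcomp Require Import all_classical all_reals all_analysis.
From mathcomp Require Import measurable_realfun.
From mathcomp Require Import ring lra.

Import Order.TTheory GRing.Theory Num.Theory numFieldNormedType.Exports.
Import Normc.
Import HBNNSimple.

Local Open Scope classical_set_scope.
Local Open Scope ring_scope.

(* The substitution x = tan (theta / 2) turns r = (1 - x^2) / (1 + x^2) into
   cos theta, 2 x / (1 + x^2) into sin theta, and wx s x dx into
   (1 + cos theta)^(s-1) dtheta, that is, into twice the Jacobi weight with
   parameters (-1/2, s - 3/2) in r on [-1, 1].  The factor sin^2 theta = 1 - r^2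
   raises both parameters by one, hence the second Jacobi family.

   Orthogonality: the vanishing of the integral of the derivative of
   (1 - r)^(a+1) (1 + r)^(b+1) p(r), with p a Wronskian of two solutions of the
   Jacobi differential equation; even and odd parts are orthogonal by parity.

   Completeness: the span of the Phi k is the algebra of all
   p(cos theta) + sin theta q(cos theta).  Iterating y |-> (3 y - y^3) / 2 on
   such a function with values in [-1, 1] converges boundedly to its sign, and
   every open interval is the positivity set of one of them, so indicators of
   intervals, then of Borel sets (pi-lambda theorem), then all of L^2 are in the
   closure.

   The phi k differ from the Phi k by a factor of squared modulus wx s x. *)

(** * The Jacobi differential equation, orthogonality and degree *)

Section JacobiAlgebra.
Context {R : realType}.
Implicit Types (a b : R) (n : nat) (p q : {poly R}).

(* The derivative of (1 - X)^(a+1) (1 + X)^(b+1) p, divided by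
   (1 - X)^a (1 + X)^b. *)
Definition jacobi_op a b p : {poly R} :=
  (1 - 'X ^+ 2) * p^`() + ((b - a)%:P - (a + b + 2)%:P * 'X) * p.

(* In these variables the Jacobi polynomials are homogeneous, and jacobi_op a b
   applied to the derivative preserves the degree. *)
Let u : {poly R} := 2^-1 *: ('X - 1).
Let v : {poly R} := 2^-1 *: ('X + 1).

Let uv_sum : 'X = u + v.
Proof.
rewrite /u /v -scalerDr addrACA addNr addr0 -mulr2n -(scaler_nat 2 'X) scalerA.
by rewrite mulVf ?scale1r// pnatr_eq0.
Qed.

Let uv_diff : v = u + 1.
Proof.
apply/(scalerI (_ : (2 : R) != 0)); first by rewrite pnatr_eq0.
rewrite scalerDr /u /v !scalerA divff ?pnatr_eq0// !scale1r.
by rewrite scaler_nat; ring.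
Qed.

(** The factor 2 absorbs the slope 1/2 of [u] and [v] and keeps the later identities free of
    fractions. At n = 0 the truncated predecessor is multiplied by 0. *)
Let deriv2 p n : p^`() = (2^-1)%:P -> 2 * (p ^+ n)^`() = n%:R * p ^+ n.-1.
Proof.
move=> dp; rewrite deriv_exp dp -mulr_natr.
rewrite [LHS](_ : _ = 2 * (2^-1)%:P * (n%:R * p ^+ n.-1)); last by ring.
rewrite -[X in X * (2^-1)%:P](rmorph_nat (@polyC R)) -polyCM.
by rewrite divff ?pnatr_eq0// mul1r.
Qed.

Let derivu : u^`() = (2^-1)%:P.
Proof. by rewrite derivZ derivB derivX derivC subr0 alg_polyC. Qed.

Let derivv : v^`() = (2^-1)%:P.
Proof. by rewrite derivZ derivD derivX derivC addr0 alg_polyC. Qed.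

(** Here 1 - X^2 = -4 u v and, since v - u = 1, the zeroth order coefficient of [jacobi_op] is -2
    ((a + 1) v + (b + 1) u). A monomial is therefore coupled only with itself and its two neighbours
    of the same total degree. *)
Let jacobi_op_monom a b j k :
  jacobi_op a b ((u ^+ j * v ^+ k)^`()) =
  - ((j%:R * (j%:R + a))%:P * (u ^+ j.-1 * v ^+ k.+1)
    + (2 * j%:R * k%:R + (a + 1) * k%:R + (b + 1) * j%:R)%:P
      * (u ^+ j * v ^+ k)
    + (k%:R * (k%:R + b))%:P * (u ^+ j.+1 * v ^+ k.-1)).
Proof.
have dnat m p : (m%:R * p)^`() = m%:R * p^`() by rewrite !mulr_natl derivMn.
have d2 p n : p^`() = (2^-1)%:P ->
    4 * (p ^+ n)^`()^`() = (n * n.-1)%:R * p ^+ n.-2.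
  move=> dp; transitivity (2 * (2 * (p ^+ n)^`())^`()).
    by rewrite dnat; ring.
  by rewrite deriv2// dnat mulrCA deriv2// natrM mulrA.
rewrite /jacobi_op !derivM !derivD !derivM.
rewrite [LHS](_ : _ = - (u * v * (4 * (u ^+ j)^`()^`() * v ^+ k
     + 2 * ((2 * (u ^+ j)^`()) * (2 * (v ^+ k)^`()))
     + u ^+ j * (4 * (v ^+ k)^`()^`()))
   + ((a + 1)%:P * v + (b + 1)%:P * u)
     * (2 * (u ^+ j)^`() * v ^+ k + u ^+ j * (2 * (v ^+ k)^`())))); last first.
  by rewrite uv_sum !(polyCD, polyCN, polyC1, rmorph_nat) uv_diff; ring.
rewrite !(deriv2 _ _ derivu) !(deriv2 _ _ derivv) !(d2 _ _ derivu)
  !(d2 _ _ derivv) !(polyCD, polyCM, polyC1, rmorph_nat).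
(* The truncated predecessors force the exponents 0 and 1 to be treated apart. *)
case: j => [|[|j]]; case: k => [|[|k]];
  by rewrite /= !(natrM, exprS, expr0) -!natr1; ring.
Qed.

Let coef a b n j : R := gbinom (n%:R + a) (n - j) * gbinom (n%:R + b) j.

Lemma gbinomS a j : gbinom a j.+1 * j.+1%:R = gbinom a j * (a - j%:R).
Proof.
rewrite /gbinom big_ord_recr/= factS natrM.
by field; rewrite ?(nat1r, natr1) !pnatr_eq0 -lt0n fact_gt0.
Qed.

(** A balance: under [jacobi_op], what monomial j + 1 sends down to j equals what monomial j sends
    up to j + 1. *)
Let coef_rec a b n j : (j < n)%N ->
  coef a b n j.+1 * (j.+1%:R * (j.+1%:R + a)) =
  coef a b n j * ((n - j)%:R * ((n - j)%:R + b)).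
Proof.
move=> jn; rewrite /coef.
have [k nk] : exists k, (n - j = k.+1)%N.
  by exists (n - j).-1; rewrite prednK// subn_gt0.
have -> : (n - j.+1 = k)%N by rewrite subnS nk.
have en : (n%:R : R) = j%:R + k.+1%:R.
  by rewrite -natrD -nk subnKC// ltnW.
have Ha := gbinomS (n%:R + a) k; have Hb := gbinomS (n%:R + b) j.
rewrite nk.
rewrite [LHS](_ : _ = gbinom (n%:R + a) k * (n%:R + a - k%:R)
   * (gbinom (n%:R + b) j.+1 * j.+1%:R)); last by rewrite en -!natr1; ring.
by rewrite -Ha Hb en -!natr1; ring.
Qed.

Definition jacobi_eigen a b n : R := n%:R * (n%:R + a + b + 1).

(** By the balance [coef_rec], the two shifted sums can be rewritten over the unshifted monomials.
    The resulting factor j (j + a) + (n - j) (n - j + b) + ... then no longer depends on j and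
    equals n (n + a + b + 1). *)
Lemma jacobi_ode a b n :
  jacobi_op a b (jacobi a b n)^`() = - jacobi_eigen a b n *: jacobi a b n.
Proof.
have opD p q : jacobi_op a b (p + q) = jacobi_op a b p + jacobi_op a b q.
  by rewrite /jacobi_op derivD; ring.
have opZ c p : jacobi_op a b (c *: p) = c *: jacobi_op a b p.
  by rewrite /jacobi_op derivZ -!scalerAr scalerDr.
have op0 : jacobi_op a b 0 = 0 by rewrite /jacobi_op deriv0 !mulr0 addr0.
pose m j := u ^+ j * v ^+ (n - j).
have -> : jacobi a b n = \sum_(j < n.+1) coef a b n j *: m j by [].
rewrite [X in jacobi_op a b X](linear_sum (@deriv R))/=.
rewrite (big_morph _ opD op0) scaler_sumr.
(* Up to the common sign, [A] and [B] are what monomial j sends to j - 1 and to j + 1, and [C] is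
   what it keeps. *)
pose A j := (coef a b n j * (j%:R * (j%:R + a))).
pose B j := (coef a b n j * ((n - j)%:R * ((n - j)%:R + b))).
pose C j := coef a b n j *
  (2 * j%:R * (n - j)%:R + (a + 1) * (n - j)%:R + (b + 1) * j%:R).
have A0 : A 0%N = 0 by rewrite /A mul0r mulr0.
have Bn : B n = 0 by rewrite /B subnn mul0r mulr0.
have BS j : (j < n)%N -> B j = A j.+1 by move=> jn; rewrite /B -coef_rec.
transitivity (- (\sum_(j < n.+1) A j *: (u ^+ j.-1 * v ^+ (n - j).+1)
   + \sum_(j < n.+1) C j *: m j
   + \sum_(j < n.+1) B j *: (u ^+ j.+1 * v ^+ (n - j).-1))).
  rewrite -!big_split/= -sumrN; apply: eq_bigr => j _.
  rewrite derivZ opZ jacobi_op_monom !mul_polyC scalerN !scalerDr !scalerA.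
  by [].
have -> : \sum_(j < n.+1) A j *: (u ^+ j.-1 * v ^+ (n - j).+1)
   = \sum_(j < n.+1) B j *: m j.
  rewrite big_ord_recl/= A0 scale0r add0r.
  rewrite [RHS]big_ord_recr/= Bn scale0r addr0.
  apply: eq_bigr => j _; rewrite BS//= /bump/= add1n.
  by rewrite /m /= -subSn// subSS.
have -> : \sum_(j < n.+1) B j *: (u ^+ j.+1 * v ^+ (n - j).-1)
   = \sum_(j < n.+1) A j *: m j.
  rewrite [RHS]big_ord_recl/= A0 scale0r add0r.
  rewrite big_ord_recr/= Bn scale0r addr0.
  by apply: eq_bigr => j _; rewrite BS// /bump/= add1n /m subnS.
rewrite -!big_split/= -sumrN; apply: eq_bigr => j _.
rewrite -!scalerDl -scaleNr scalerA; congr (_ *: _).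
rewrite /A /B /C /jacobi_eigen.
have -> : (n%:R : R) = j%:R + (n - j)%:R by rewrite -natrD subnKC// -ltnS.
by ring.
Qed.

(** The difference of two eigenvalues is (n - m) (n + m + a + b + 1); for m < n one has n >= 1, and
    a + b > -2 makes the second factor positive. *)
Lemma jacobi_eigen_inj a b : - 1 < a -> - 1 < b ->
  injective (jacobi_eigen a b).
Proof.
move=> a1 b1.
have lt m n : (m < n)%N -> jacobi_eigen a b m < jacobi_eigen a b n.
  move=> mn; rewrite /jacobi_eigen -subr_gt0.
  rewrite (_ : _ - _ = (n%:R - m%:R) * (n%:R + m%:R + a + b + 1)); last by ring.
  apply: mulr_gt0; first by rewrite subr_gt0 ltr_nat.
  have : 1 <= (n%:R : R) by rewrite ler1n (leq_trans _ mn).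
  have : 0 <= (m%:R : R) by rewrite ler0n.
  by lra.
move=> m n e; case: (ltngtP m n) => // /lt; by rewrite e ltxx.
Qed.

(* L stands for integration against the Jacobi weight; the hypothesis on
   jacobi_op is integration by parts without boundary term. *)
Lemma jacobi_orthogonal a b (L : {poly R} -> R) :
  - 1 < a -> - 1 < b ->
  (forall c p, L (c *: p) = c * L p) ->
  (forall p, L (jacobi_op a b p) = 0) ->
  forall m n, m != n -> L (jacobi a b m * jacobi a b n) = 0.
Proof.
move=> a1 b1 LZ L0 m n mn.
(* In the image of this Wronskian the products of first derivatives cancel, and the differential
   equation leaves the product PQ times a difference of eigenvalues. *)
have := L0 (jacobi a b m * (jacobi a b n)^`() - jacobi a b n * (jacobi a b m)^`()).
set P := jacobi a b m; set Q := jacobi a b n.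
rewrite (_ : jacobi_op _ _ _ = P * jacobi_op a b Q^`() - Q * jacobi_op a b P^`());
  last by rewrite /jacobi_op derivD derivN !derivM; ring.
rewrite !jacobi_ode -!scalerAr (mulrC Q) -scalerBl LZ => /eqP.
rewrite mulf_eq0 opprK addrC subr_eq0 => /orP[/eqP|/eqP//].
by move/jacobi_eigen_inj => e; move: mn; rewrite e ?eqxx.
Qed.

Lemma gbinom_gt0 a j : j%:R - 1 < a -> 0 < gbinom a j.
Proof.
move=> ja; rewrite /gbinom divr_gt0 ?ltr0n ?fact_gt0// prodr_gt0// => i _.
have : ((i.+1)%:R : R) <= j%:R by rewrite ler_nat.
by rewrite -natr1; lra.
Qed.

(** Every term of the sum is a positive multiple of a monic polynomial of degree n, so the leading
    coefficients cannot cancel. *)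
Lemma size_jacobi a b n : - 1 < a -> - 1 < b -> size (jacobi a b n) = n.+1.
Proof.
move=> a1 b1.
have cp j : (j <= n)%N -> 0 < coef a b n j.
  move=> jn; have : (j%:R : R) <= n%:R by rewrite ler_nat.
  have : ((n - j)%:R : R) <= n%:R by rewrite ler_nat leq_subr.
  by move=> ? ?; apply: mulr_gt0; apply: gbinom_gt0; lra.
have sz j : (j <= n)%N -> u ^+ j * v ^+ (n - j) =
    2^-1 ^+ n *: (('X - 1%:P) ^+ j * ('X - (-1)%:P) ^+ (n - j)).
  move=> jn; rewrite polyCN opprK polyC1 /u /v !exprZn -scalerAl -scalerAr.
  by rewrite scalerA -exprD subnKC.
have mon j : ('X - 1%:P : {poly R}) ^+ j * ('X - (-1)%:P) ^+ (n - j) \is monic.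
  by rewrite rpredM// rpredX// monicXsubC.
have szm j : (j <= n)%N ->
    size (('X - 1%:P : {poly R}) ^+ j * ('X - (-1)%:P) ^+ (n - j)) = n.+1.
  move=> jn; rewrite size_proper_mul ?(eqP (monic_exp _ (monicXsubC _))) ?mul1r ?oner_eq0//.
  by rewrite !size_exp_XsubC addSn addnS/= subnKC.
have le_ord (j : 'I_n.+1) : (j <= n)%N by rewrite -ltnS.
have -> : jacobi a b n = \sum_(j < n.+1) coef a b n j *: (u ^+ j * v ^+ (n - j)).
  by [].
apply/eqP; rewrite eqn_leq; apply/andP; split.
  apply: (leq_trans (size_sum _ _ _)); apply/bigmax_leqP => j _.
  apply: (leq_trans (size_scale_leq _ _)).
  by rewrite (sz _ (le_ord j)) (leq_trans (size_scale_leq _ _))// szm.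
rewrite ltnNge; apply/negP => szn.
have := nth_default 0 szn.
have co j : (j <= n)%N -> 0 < (coef a b n j *: (u ^+ j * v ^+ (n - j)))`_n.
  move=> jn; rewrite sz// scalerA coefZ.
  rewrite (_ : _`_n = 1) ?mulr1; last first.
    by rewrite -[RHS](eqP (mon j)) lead_coefE szm.
  by rewrite mulr_gt0 ?exprn_gt0 ?invr_gt0// cp.
rewrite coef_sum; apply/eqP; rewrite psumr_neq0 => [|j _]; last exact/ltW/co.
by apply/hasP; exists ord0; rewrite ?mem_index_enum//= co.
Qed.

End JacobiAlgebra.

(** * The coordinate x = tan (theta / 2) and the weight on the line *)

Section Cayley.
Context {R : realType}.
Implicit Types (x s : R) (p : {poly R}).

Definition ccos x : R := (1 - x ^+ 2) / (1 + x ^+ 2).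
Definition csin x : R := 2 * x / (1 + x ^+ 2).

Lemma onexsq_gt0 x : 0 < 1 + x ^+ 2.
Proof. by rewrite ltr_pwDl// sqr_ge0. Qed.

Lemma onexsq_neq0 x : 1 + x ^+ 2 != 0.
Proof. by rewrite gt_eqF// onexsq_gt0. Qed.

Lemma ccosD1 x : 1 + ccos x = 2 / (1 + x ^+ 2).
Proof. by rewrite /ccos; field; rewrite onexsq_neq0. Qed.

Lemma ccosB1 x : 1 - ccos x = x ^+ 2 * (2 / (1 + x ^+ 2)).
Proof. by rewrite /ccos; field; rewrite onexsq_neq0. Qed.

Lemma csinE x : csin x = x * (1 + ccos x).
Proof. by rewrite /csin ccosD1; field; rewrite onexsq_neq0. Qed.

Lemma csin_sqr x : csin x ^+ 2 = 1 - ccos x ^+ 2.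
Proof. by rewrite /ccos /csin; field; rewrite onexsq_neq0. Qed.

Lemma ccosN x : ccos (- x) = ccos x.
Proof. by rewrite /ccos sqrrN. Qed.

Lemma csinN x : csin (- x) = - csin x.
Proof. by rewrite /csin sqrrN mulrN mulNr. Qed.

Lemma ccosD1_gt0 x : 0 < 1 + ccos x.
Proof. by rewrite ccosD1 divr_gt0// onexsq_gt0. Qed.

Lemma ccosB1_ge0 x : 0 <= 1 - ccos x.
Proof. by rewrite ccosB1 mulr_ge0 ?sqr_ge0// -ccosD1 ltW// ccosD1_gt0. Qed.

Lemma normr_ccos_le1 x : `|ccos x| <= 1.
Proof. by rewrite ler_norml; have := ccosD1_gt0 x; have := ccosB1_ge0 x; lra. Qed.

Lemma normr_csin_le1 x : `|csin x| <= 1.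
Proof.
rewrite -(@ler_sqr _ _ 1) ?nnegrE// real_normK ?num_real// csin_sqr expr1n.
by rewrite gerDl oppr_le0 sqr_ge0.
Qed.

Lemma is_derive_ccos x : is_derive x 1 ccos (- 2 * csin x / (1 + x ^+ 2)).
Proof.
have -> : ccos = fun y => 2 * (1 + y ^+ 2)^-1 - 1.
  by apply/funext => y; rewrite /ccos; field; rewrite onexsq_neq0.
have dV : is_derive x 1 (fun y : R => (1 + y ^+ 2)^-1)
    (- (1 + x ^+ 2) ^- 2 *: (2 * x)).
  apply: is_deriveV; first exact: onexsq_neq0.
  by apply: is_derive_eq; rewrite /GRing.scale/=; ring.
apply: is_derive_eq; rewrite /GRing.scale/= /csin.
by field; rewrite onexsq_neq0.
Qed.

Lemma continuous_ccos : continuous ccos.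
Proof.
move=> x; have [d _] := is_derive_ccos x.
by apply/differentiable_continuous/derivable1_diffP.
Qed.

Lemma continuous_csin : continuous csin.
Proof.
move=> x; rewrite (_ : csin = fun y => y * (1 + ccos y)); last first.
  by apply/funext => y; rewrite csinE.
apply: cvgM; first exact: cvg_id.
by apply: cvgD; [exact: cvg_cst|exact: continuous_ccos].
Qed.

Lemma wxE s x : wx s x = (1 + ccos x) `^ s.
Proof.
rewrite /wx ccosD1 powRM ?invr_ge0// 1?ltW ?onexsq_gt0//.
rewrite -(powR_inv1 (ltW (onexsq_gt0 x))) -powRrM -powRN; congr (_ * _ `^ _); ring.
Qed.

Lemma wx_gt0 s x : 0 < wx s x.
Proof. by rewrite wxE powR_gt0// ccosD1_gt0. Qed.

Lemma is_derive_wx s x : is_derive x 1 (wx s) (- s * csin x * wx s x).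
Proof.
rewrite (_ : wx s = (@powR R ^~ s) \o (fun y => 1 + ccos y)); last first.
  by apply/funext => y; rewrite wxE.
have dp := is_derive1_powR s (ccosD1_gt0 x).
have dc : is_derive x 1 (fun y : R => 1 + ccos y)
    (- 2 * csin x / (1 + x ^+ 2)).
  have dc := is_derive_ccos x.
  by apply: is_derive_eq; rewrite add0r mul1r.
have c0 := ccosD1_gt0 x.
apply: is_derive_eq; rewrite /= powRB ?(gt_eqF c0) ?implybT//.
by rewrite (powRr1 (ltW c0)) ccosD1; field; rewrite onexsq_neq0.
Qed.

(** * Decay and integrability of the weight *)

Lemma is_derive_1D x : is_derive x 1 (fun y : R => 1 + y) 1.
Proof.
have := is_deriveD (is_derive_cst (1 : R) x 1) (is_derive_id x 1).
by rewrite add0r.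
Qed.

Lemma powR_cvgy0 (c : R) : 0 < c -> (1 + x) `^ (- c) @[x --> +oo%R] --> 0.
Proof.
move=> c0; apply/cvgrPdist_lt => e e0; near=> x.
have x0 : 0 < x by near: x; exact: nbhs_pinfty_gt.
(* Beyond this threshold x^c exceeds 1/e. *)
have xe : (e^-1) `^ (c^-1) < x by near: x; exact: nbhs_pinfty_gt.
rewrite sub0r normrN ger0_norm ?powR_ge0// powRN.
rewrite invf_plt ?posrE ?powR_gt0//; last by rewrite ltr_pwDl// ltW.
rewrite [ltLHS](_ : _ = (e^-1 `^ c^-1) `^ c); last first.
  by rewrite -powRrM mulVf ?lt0r_neq0// powRr1 ?invr_ge0 ?ltW.
rewrite gt0_ltr_powR ?nnegrE ?powR_ge0//; first by rewrite addr_ge0 ?ltW.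
by rewrite (lt_trans xe)// ltrDr.
Unshelve. all: by end_near. Qed.

Lemma continuous_wx s : continuous (wx s).
Proof.
move=> x; have [d _] := is_derive_wx s x.
by apply/differentiable_continuous/derivable1_diffP.
Qed.

(** From (1 + x)^2 <= 2 (1 + x^2). The dominating power has an explicit antiderivative. *)
Lemma wx_le s x : 0 < s -> 0 <= x ->
  wx s x <= 4 `^ s * (1 + x) `^ (- (2 * s)).
Proof.
move=> s0 x0; rewrite wxE.
have x1 : 0 < 1 + x by rewrite ltr_pwDl.
rewrite -mulNr powRrM -powRM ?powR_ge0//.
apply: ge0_ler_powR; rewrite ?nnegrE ?mulr_ge0 ?powR_ge0 ?(ltW s0)//.
  exact/ltW/ccosD1_gt0.
rewrite ccosD1 powRN (powR_mulrn 2) ?(ltW x1)//.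
rewrite ler_pdivrMr ?onexsq_gt0// mulrAC ler_pdivlMr ?exprn_gt0//.
by have := sqr_ge0 (1 - x); lra.
Qed.

Lemma wxN s x : wx s (- x) = wx s x.
Proof. by rewrite /wx sqrrN. Qed.

(** By symmetry the half-line suffices; there the bound [wx_le] has an antiderivative proportional
    to (1 + x)^(1 - 2 s), which tends to 0 because 2 s > 1. *)
Lemma wx_lty s : 2^-1 < s -> (\int[@lebesgue_measure R]_x (wx s x)%:E < +oo)%E.
Proof.
move=> hs; rewrite ge0_symfun_integralT; last 3 first.
- by move=> x; rewrite ltW// wx_gt0.
- exact: continuous_wx.
- by move=> x; rewrite /= wxN.
have s0 : 0 < s by lra.
have mw : measurable_fun setT (wx s).
  by apply: continuous_measurable_fun; exact: continuous_wx.
rewrite lte_mul_pinfty// -set_itvcy.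
pose c := 2 * s - 1.
have c0 : 0 < c by rewrite /c; lra.
pose F (x : R) := - c^-1 * (1 + x) `^ (- c).
pose f (x : R) := (1 + x) `^ (- (2 * s)).
have dF x : 0 <= x -> is_derive x 1 F (f x).
  move=> x0; have x1 : 0 < 1 + x by rewrite ltr_pwDl.
  have d1 := is_derive1_powR (- c) x1.
  have d2 := is_derive_1D x.
  have d3 := is_derive1_comp d1 d2.
  apply: is_derive_eq; rewrite /GRing.scale/= /f mulr1 mulrA mulrNN mulVf ?gt_eqF// mul1r.
  by congr (_ `^ _); rewrite /c; ring.
have dfF x : 0 <= x -> derivable f x 1.
  move=> x0; have x1 : 0 < 1 + x by rewrite ltr_pwDl.
  have d1 := is_derive1_powR (- (2 * s)) x1.
  have d2 := is_derive_1D x.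
  by have [] := is_derive1_comp d1 d2.
have cts (g : R -> R) x : derivable g x 1 -> {for x, continuous g}.
  by move=> ?; exact/differentiable_continuous/derivable1_diffP.
have mf : measurable_fun `[(0 : R), +oo[ f.
  apply: measurable_funTS.
  by apply: (measurableT_comp (measurable_powR _)); exact: measurable_funD.
have intf : (\int[@lebesgue_measure R]_(x in `[(0 : R)%R, +oo[) (f x)%:E < +oo)%E.
  rewrite (@ge0_continuous_FTC2y _ f F 0 0) ?ltry//.
  - by move=> x _; exact: powR_ge0.
  - apply/continuous_within_itvcyP; split.
    + by move=> x; rewrite in_itv/= andbT => /ltW x0; exact/cts/dfF.
    + by apply: cvg_at_right_filter; exact/cts/dfF.
  - rewrite -[X in _ --> X](mulr0 (- c^-1)).
    by apply: cvgM; [exact: cvg_cst|exact: powR_cvgy0].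
  - by move=> x /ltW/dF[].
  - by apply: cvg_at_right_filter; apply: cts; have [] := dF 0 (lexx _).
  - move=> x; rewrite in_itv/= andbT => /ltW/dF d.
    by rewrite derive1E; exact: derive_val.
apply: (@le_lt_trans _ _ (\int[@lebesgue_measure R]_(x in `[(0 : R)%R, +oo[)
  ((4 `^ s)%:E * (f x)%:E))%E).
  apply: ge0_le_integral => //.
  - by move=> x _; rewrite lee_fin ltW// wx_gt0.
  - by apply/measurable_EFinP/measurable_funTS.
  - apply/measurable_EFinP; exact: measurable_funM.
  - by move=> x; rewrite /= in_itv/= andbT => x0; rewrite lee_fin wx_le.
rewrite ge0_integralZl//; [|exact/measurable_EFinP|by move=> *; rewrite lee_fin powR_ge0].
by rewrite lte_mul_pinfty.
Qed.

Local Notation mu := (@lebesgue_measure R).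

Lemma measurable_wx s : measurable_fun [set: R] (wx s).
Proof. by apply: continuous_measurable_fun; exact: continuous_wx. Qed.

Lemma integrable_wx s : 2^-1 < s -> mu.-integrable setT (EFin \o wx s).
Proof.
move=> hs; apply/integrableP; split.
  by apply/measurable_EFinP; exact: measurable_wx.
under eq_integral do rewrite /= ger0_norm ?(ltW (wx_gt0 _ _))//.
exact: wx_lty.
Qed.

Lemma integrable_bounded_wx s (f : R -> R) M : 2^-1 < s ->
  measurable_fun setT f -> (forall x, `|f x| <= M) ->
  mu.-integrable setT (fun x => (f x * wx s x)%:E).
Proof.
move=> hs mf fM.
apply: (@le_integrable _ _ _ mu _ measurableT _ (fun x => (M%:E * (wx s x)%:E)%E)).
- by apply/measurable_EFinP/measurable_funM => //; exact: measurable_wx.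
- move=> x _; rewrite /= lee_fin !normrM ler_wpM2r//.
  exact: le_trans (fM x) (ler_norm _).
- by apply: integrableZl => //; exact: integrable_wx.
Qed.

Lemma poly_bounded p : exists2 M, 0 <= M & forall r : R, `|r| <= 1 -> `|p.[r]| <= M.
Proof.
elim/poly_ind: p => [|p c [M M0 pM]].
  by exists 0 => // r _; rewrite horner0 normr0.
exists (M + `|c|) => [|r r1]; first by rewrite addr_ge0.
rewrite hornerMXaddC (le_trans (ler_normD _ _))// lerD2r normrM.
by rewrite -[M]mulr1 ler_pM// pM.
Qed.

Lemma continuous_horner_ccos p : continuous (fun x => p.[ccos x]).
Proof.
by move=> x; apply: continuous_comp; [exact: continuous_ccos|exact: continuous_horner].
Qed.

Lemma measurable_horner_ccos p : measurable_fun [set: R] (fun x : R => p.[ccos x]).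
Proof. by apply: continuous_measurable_fun; exact: continuous_horner_ccos. Qed.

Lemma integrable_horner_ccos s p : 2^-1 < s ->
  mu.-integrable setT (fun x => (p.[ccos x] * wx s x)%:E).
Proof.
move=> hs; have [M _ pM] := poly_bounded p.
apply: (integrable_bounded_wx _ _ M) => //; first exact: measurable_horner_ccos.
by move=> x; rewrite pM// normr_ccos_le1.
Qed.

(* Twice the integral of p against the Jacobi weight (-1/2, s - 3/2), pulled back
   to the line; see integral_jw. *)
Definition cay_int s p : R := \int[mu]_x (p.[ccos x] * wx s x).

Lemma cay_intZ s c p : 2^-1 < s -> cay_int s (c *: p) = c * cay_int s p.
Proof.
move=> hs; rewrite /cay_int.
under eq_Rintegral do rewrite hornerZ -mulrA.
by rewrite RintegralZl//; exact: integrable_horner_ccos.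
Qed.

(** Dominated convergence with |f| as majorant. It reduces integrals over the line to symmetric
    compact intervals, where the fundamental theorem of calculus and reflection apply. *)
Lemma cvg_Rintegral_symitv (f : R -> R) : mu.-integrable setT (EFin \o f) ->
  \int[mu]_(x in `[- n%:R, n%:R]) f x @[n --> \oo] --> \int[mu]_x f x.
Proof.
move=> intf.
pose f_ n := (EFin \o f) \_ `[- n%:R, (n%:R : R)].
have mf := measurable_int _ intf.
have f_f x : f_ n x @[n --> \oo] --> (f x)%:E.
  apply: cvg_near_cst; near=> n.
  rewrite /f_ patchE mem_set//= in_itv/= -ler_norml ltW//.
  by near: n; exact: nbhs_infty_gtr.
have [|||||_ _] := @dominated_convergence _ _ _ mu _ measurableT f_
  (EFin \o f) (abse \o (EFin \o f)).
- move=> n; apply/(measurable_restrictT (EFin \o f)) => //.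
  exact: measurable_funTS.
- exact: mf.
- by apply: aeW => x _; exact: f_f.
- exact: integrable_abse.
- apply: aeW => x n _; rewrite /f_ patchE /=; case: ifPn => // _.
  by rewrite abse0 lee_fin.
move=> h.
apply: fine_cvg; rewrite fineK; last exact: integrable_fin_num.
under eq_cvg do rewrite integral_mkcond.
exact: h.
Unshelve. all: by end_near. Qed.

End Cayley.

(** * Integration by parts on the line *)

Section CayleyIntegral.
Context {R : realType}.
Implicit Types (x s : R) (p : {poly R}).
Local Notation mu := (@lebesgue_measure R).

(** With r = [ccos x], 1 - r = x^2 (1 + r). For x > 0 the factor x * [wx s x] is thus (1 - r)^(1/2)
    (1 + r)^(s - 1/2), the Jacobi weight with both parameters raised by one. *)
Lemma is_derive_bdry s p x :
  is_derive x 1 (fun y => p.[ccos y] * (y * wx s y))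
    (- ((jacobi_op (- 2^-1) (s - 3 / 2) p).[ccos x] * wx s x)).
Proof.
have dc := is_derive_ccos x.
have dp := is_derive1_comp (is_derive_poly p (ccos x)) dc.
have dw := is_derive_wx s x.
have dM := is_deriveM dp (is_deriveM (is_derive_id x 1) dw).
apply: is_derive_eq; rewrite /GRing.scale/= /jacobi_op.
rewrite (_ : (id * wx s) x = x * wx s x)//.
rewrite -polyC1 !(hornerD, hornerM, hornerN, hornerC, hornerX, hornerXn).
move: (p.[_]) (p^`().[_]) (wx s x) => P P' w.
by rewrite /csin /ccos; field; exact: onexsq_neq0.
Qed.

(** The polynomial factor is bounded and x * [wx s x] is of order x^(1 - 2 s), a negative power. *)
Lemma bdry_cvg0 s p : 2^-1 < s -> (p.[ccos x] * (x * wx s x)) @[x --> +oo%R] --> 0.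
Proof.
move=> hs; have [M M0 pM] := poly_bounded p.
apply: norm_cvg0.
apply: (@squeeze_cvgr _ _ _ _ (fun=> 0)
  (fun x => (M * 4 `^ s) * (1 + x) `^ (- (2 * s - 1)))).
- near=> x; rewrite normr_ge0/= normrM -mulrA ler_pM//.
    by rewrite pM// normr_ccos_le1.
  have x0 : 0 < x by near: x; exact: nbhs_pinfty_gt.
  have x1 : 0 < 1 + x by rewrite ltr_pwDl// ltW.
  rewrite ger0_norm; last exact: mulr_ge0 (ltW x0) (ltW (wx_gt0 s x)).
  apply: (@le_trans _ _ ((1 + x) * (4 `^ s * (1 + x) `^ (- (2 * s))))).
    apply: ler_pM; rewrite ?(ltW x0) ?(ltW (wx_gt0 _ _)) ?lerDr//.
    by apply: wx_le; [lra|exact: ltW].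
  rewrite mulrCA ler_wpM2l ?powR_ge0// -[X in X * _ <= _](powRr1 (ltW x1)).
  rewrite -powRD; last by rewrite (gt_eqF x1) implybT.
  by rewrite le_eqVlt; apply/orP; left; apply/eqP; congr (_ `^ _); ring.
- exact: cvg_cst.
- rewrite -[X in _ --> X](mulr0 (M * 4 `^ s)).
  by apply: cvgM; [exact: cvg_cst|apply: powR_cvgy0; lra].
Unshelve. all: by end_near. Qed.

(** The integrand is the derivative of -G by [is_derive_bdry]. As G is odd, the integral over
    [-n, n] is -2 G(n), which tends to 0. *)
Lemma cay_int_jacobi_op s p : 2^-1 < s ->
  cay_int s (jacobi_op (- 2^-1) (s - 3 / 2) p) = 0.
Proof.
move=> hs.
pose q := jacobi_op (- 2^-1) (s - 3 / 2) p.
pose G y := p.[ccos y] * (y * wx s y).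
have cq : continuous (fun x : R => q.[ccos x] * wx s x).
  by move=> x; apply: cvgM; [exact: continuous_horner_ccos|exact: continuous_wx].
have cG : continuous G.
  move=> x; have [d _] := is_derive_bdry s p x.
  exact/differentiable_continuous/derivable1_diffP.
have intq := integrable_horner_ccos s q hs.
have GN y : G (- y) = - G y by rewrite /G ccosN wxN; ring.
have FTC n : (0 < n)%N ->
    \int[mu]_(x in `[- n%:R, n%:R]) (q.[ccos x] * wx s x) = - (2 * G n%:R).
  move=> n0.
  have n1 : - n%:R < n%:R :> R.
    by rewrite -subr_gt0 opprK -natrD ltr0n addn_gt0 n0.
  rewrite /Rintegral (@continuous_FTC2 R _ (- G) _ _ n1).
  - by rewrite -EFinB/= /= fctE GN; ring.
  - by apply: continuous_subspaceT.
  - split => [x _||]; last 2 first.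
    + by apply: cvg_at_right_filter; apply: cvgN; exact: cG.
    + by apply: cvg_at_left_filter; apply: cvgN; exact: cG.
    + by apply: derivableN; have [] := is_derive_bdry s p x.
  - move=> x _; rewrite derive1E deriveN; last by have [] := is_derive_bdry s p x.
    by rewrite (@derive_val _ _ _ _ _ _ _ (is_derive_bdry s p x)) opprK.
have h1 := @cvg_Rintegral_symitv _ _ intq.
have h2 : (fun n : nat => - (2 * G n%:R)) @ \oo --> (0 : R).
  rewrite -oppr0 -(mulr0 2); apply: cvgN; apply: cvgM; first exact: cvg_cst.
  exact: (cvg_comp _ _ cvgr_idn (bdry_cvg0 _ _ hs)).
apply: (@cvg_unique _ (@Rhausdorff R) _ _ _ _ h1).
apply: cvg_trans h2; apply: near_eq_cvg; near=> n.
rewrite FTC//; near: n; exact: nbhs_infty_gt.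
Unshelve. all: by end_near. Qed.

(** * Change of variables between the line and [-1, 1] *)

Lemma ccos_decr x y : 0 <= x -> x < y -> ccos y < ccos x.
Proof.
move=> x0 xy; rewrite -(ltrD2l 1) !ccosD1 ltr_pM2l// ltf_pV2 ?posrE ?onexsq_gt0//.
by rewrite ltrD2l ltrXn2r// ?nnegrE// ltW// (le_lt_trans x0).
Qed.

Lemma ccos_onto (r : R) : -1 < r < 1 -> exists2 x, 0 < x & ccos x = r.
Proof.
(* This is tan (theta / 2) expressed through r = cos theta. *)
move=> /andP[r1 r2]; exists (Num.sqrt ((1 - r) / (1 + r))).
  by rewrite sqrtr_gt0 divr_gt0//; lra.
rewrite /ccos sqr_sqrtr; last by rewrite divr_ge0//; lra.
by field; do ?[apply/andP; split]; apply/lt0r_neq0; lra.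
Qed.

Lemma derive_ccos : (@ccos R)^`()%classic = fun x => - 2 * csin x / (1 + x ^+ 2).
Proof.
apply/funext => x; rewrite derive1E.
exact: (@derive_val _ _ _ _ _ _ _ (is_derive_ccos x)).
Qed.

Lemma continuous_derive_ccos : continuous ((@ccos R)^`()%classic).
Proof.
rewrite derive_ccos => x; apply: cvgM.
  by apply: cvgM; [exact: cvg_cst|exact: continuous_csin].
apply: cvgV; first exact: onexsq_neq0.
by apply: cvgD; [exact: cvg_cst|exact: exprn_continuous].
Qed.

Let jw s (g : {poly R}) (r : R) :=
  g.[r] * ((1 - r) `^ (- 2^-1) * (1 + r) `^ (s - 3 / 2)).

Let measurable_jw s g : measurable_fun [set: R] (jw s g).
Proof.
apply: measurable_funM.
  by apply: continuous_measurable_fun; exact: continuous_horner.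
by apply: measurable_funM; apply: (measurableT_comp (measurable_powR _));
  [exact: measurable_funB|exact: measurable_funD].
Qed.

Let continuous_jw s g (r : R) : -1 < r < 1 -> {for r, continuous (jw s g)}.
Proof.
move=> /andP[r1 r2].
have pc (a c : R) : 0 < c -> {for c, continuous (@powR R ^~ a)}.
  move=> c0; have [d _] := is_derive1_powR a c0.
  exact/differentiable_continuous/derivable1_diffP.
apply: cvgM; first exact: continuous_horner.
apply: cvgM.
  apply: (@continuous_comp _ _ _ (fun x : R => 1 - x) (@powR R ^~ (- 2^-1))).
    by apply: cvgB; [exact: cvg_cst|exact: cvg_id].
  by apply: pc; lra.
apply: (@continuous_comp _ _ _ (fun x : R => 1 + x) (@powR R ^~ (s - 3 / 2))).
  by apply: cvgD; [exact: cvg_cst|exact: cvg_id].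
by apply: pc; lra.
Qed.

(** The Jacobian is x (1 + r)^2 and (1 - r)^(-1/2) = x^-1 (1 + r)^(-1/2). The powers of x cancel and
    the exponents of 1 + r add up to -1/2 + (s - 3/2) + 2 = s. *)
Let jw_ccos s g x : 0 < x ->
  jw s g (ccos x) * (2 * csin x / (1 + x ^+ 2)) = g.[ccos x] * wx s x.
Proof.
move=> x0; rewrite /jw -(mulrA g.[_]); congr (_ * _).
have c0 := ccosD1_gt0 x.
rewrite wxE ccosB1 -ccosD1 powRM ?sqr_ge0 ?(ltW c0)//.
have -> : (x ^+ 2) `^ (- 2^-1) = x^-1.
  rewrite -(powR_mulrn 2 (ltW x0)) -powRrM mulrN divff ?pnatr_eq0//.
  by rewrite powR_inv1 ?ltW.
rewrite (_ : 2 * csin x / _ = x * ((1 + ccos x) * (1 + ccos x))); last first.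
  by rewrite csinE ccosD1; field; exact: onexsq_neq0.
rewrite [LHS](_ : _ = (1 + ccos x) `^ (- 2^-1) * (1 + ccos x) `^ (s - 3 / 2) *
  ((1 + ccos x) * (1 + ccos x))); last by field; exact/lt0r_neq0.
rewrite -[X in _ * (X * _)](powRr1 (ltW c0)) -[X in _ * (_ * X)](powRr1 (ltW c0)).
rewrite -!powRD ?(gt_eqF c0) ?implybT//; congr (_ `^ _); lra.
Qed.
(* The substitution is done on compact intervals first: the Jacobi weight may be
   singular at both ends of [-1, 1]. *)
Lemma integral_jw_itv s g (a b : R) : 0 < a -> a < b ->
  (\int[mu]_(r in `[ccos b, ccos a]) (jw s g r)%:E =
   \int[mu]_(x in `[a, b]) (g.[ccos x] * wx s x)%:E)%E.
Proof.
move=> a0 ab.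
have cts := @continuous_derive_ccos.
rewrite integration_by_substitution_decreasing ?ltW//.
- apply: eq_integral => x; rewrite inE/= in_itv/= => /andP[ax _]; congr (_%:E).
  rewrite -jw_ccos ?(lt_le_trans a0)//= derive_ccos.
  by rewrite !fctE !mulNr opprK.
- move=> x y; rewrite !in_itv/= => /andP[ax _] /andP[ay _] xy.
  by apply: ccos_decr => //; rewrite (le_trans (ltW a0)).
- by apply: cvgP; apply: cvg_at_right_filter; exact: cts.
- by apply: cvgP; apply: cvg_at_left_filter; exact: cts.
- split => [x _||].
  + by have [] := is_derive_ccos x.
  + by apply: cvg_at_right_filter; exact: continuous_ccos.
  + by apply: cvg_at_left_filter; exact: continuous_ccos.
- apply: continuous_in_subspaceT => r; rewrite inE/= in_itv/= => /andP[br ra].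
  apply: continuous_jw; rewrite (lt_le_trans _ br)/=; last first.
    by have := ccosD1_gt0 b; lra.
  apply: (le_lt_trans ra); rewrite -subr_gt0 ccosB1 -ccosD1.
  by rewrite mulr_gt0 ?exprn_gt0 ?ccosD1_gt0.
Qed.

(** Evenness in x gives the factor 2. Compact intervals exhaust the open half-line while their
    images under [ccos] exhaust ]-1, 1[; since both integrands are nonnegative there, monotone
    convergence applies on each side. *)
Lemma integral_jw s g : (forall r : R, `|r| <= 1 -> 0 <= g.[r]) ->
  (\int[mu]_x (g.[ccos x] * wx s x)%:E =
   2%:E * \int[mu]_(r in `[(- 1 : R)%R, 1%R])
     (g.[r] * ((1 - r) `^ (- 2^-1) * (1 + r) `^ (s - 3 / 2)))%:E)%E.
Proof.
move=> g0.
have F0 x : 0 <= g.[ccos x] * wx s x.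
  by rewrite mulr_ge0 ?g0 ?normr_ccos_le1// ltW// wx_gt0.
have cF : continuous (fun x : R => g.[ccos x] * wx s x).
  by move=> x; apply: cvgM; [exact: continuous_horner_ccos|exact: continuous_wx].
rewrite ge0_symfun_integralT//; last by move=> x; rewrite /= ccosN wxN.
congr (_ * _)%E; rewrite -set_itvcy -/(jw s g).
have mF : measurable_fun [set: R] (fun x => (g.[ccos x] * wx s x)%:E).
  by apply/measurable_EFinP; exact: continuous_measurable_fun.
have mW : measurable_fun [set: R] (fun r => (jw s g r)%:E).
  by apply/measurable_EFinP; exact: measurable_jw.
transitivity (\int[mu]_(x in `](0 : R)%R, +oo[) (g.[ccos x] * wx s x)%:E)%E.
  by rewrite [RHS]integral_itv_obnd_cbnd//; exact: measurable_funTS.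
transitivity (\int[mu]_(r in `](- 1 : R)%R, 1%R[) (jw s g r)%:E)%E; last first.
  by rewrite [RHS]integral_itv_bndoo//; exact: (measurable_funTS mW).
(* The shifts by 1 and 2 ensure a n <= 1 < b n already at n = 0. *)
pose a n : R := n.+1%:R^-1; pose b n : R := n.+2%:R.
have a0 n : 0 < a n by rewrite invr_gt0.
have ab n : a n < b n.
  by rewrite (@le_lt_trans _ _ 1)// ?ltr1n// invf_le1// ler1n.
have aS n : a n.+1 <= a n by rewrite lef_pV2 ?posrE// ler_nat.
have bS n : b n <= b n.+1 by rewrite ler_nat.
have ccos_le x y : 0 < x -> x <= y -> ccos y <= ccos x.
  by move=> x0; rewrite le_eqVlt => /predU1P[->//|/ccos_decr h]; rewrite ltW// h// ltW.
have exn x : 0 < x -> exists n, a n <= x <= b n.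
  move=> x0; have [n] : exists n : nat, Num.max x x^-1 < n%:R.
    by exists (Num.truncn (Num.max x x^-1)).+1; rewrite truncnS_gt.
  rewrite gt_max => /andP[xn xn']; exists n; apply/andP; split.
    rewrite -[leRHS]invrK lef_pV2 ?posrE ?invr_gt0// ltW// (lt_trans xn')//.
    by rewrite ltr_nat.
  by rewrite ltW// (lt_trans xn)// ltr_nat.
have AU : `]0, +oo[%classic = \bigcup_n `[a n, b n]%classic.
  apply/seteqP; split => [x|x [n _]]; rewrite /= !in_itv/= ?andbT.
    by move=> /exn[n nx]; exists n => //; rewrite /= in_itv.
  by move=> /andP[ax _]; exact: lt_le_trans ax.
have BU : `]-1, (1 : R)[%classic = \bigcup_n `[ccos (b n), ccos (a n)]%classic.
  apply/seteqP; split => [r|r [n _]]; rewrite /= !in_itv/=.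
    move=> /ccos_onto[x x0 <-]; have [n /andP[ax xb]] := exn x x0.
    by exists n => //; rewrite /= in_itv/= !ccos_le.
  move=> /andP[br ra]; rewrite (lt_le_trans _ br)/=; last first.
    by have := ccosD1_gt0 (b n); lra.
  apply: (le_lt_trans ra); rewrite -subr_gt0 ccosB1 -ccosD1.
  by rewrite mulr_gt0 ?exprn_gt0 ?ccosD1_gt0.
have cvgA : (\int[mu]_(x in `[a n, b n]) (g.[ccos x] * wx s x)%:E)%E @[n --> \oo] -->
    (\int[mu]_(x in `](0 : R)%R, +oo[) (g.[ccos x] * wx s x)%:E)%E.
  rewrite AU; apply: ge0_nondecreasing_set_cvg_integral => //.
  - apply/nondecreasing_seqP => n; apply/subsetPset => x; rewrite /= !in_itv/=.
    by move=> /andP[ax xb]; rewrite (le_trans _ ax)// (le_trans xb).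
  - by move=> n; exact: measurable_funTS.
  - by move=> n x _; rewrite lee_fin.
have cvgB : (\int[mu]_(r in `[ccos (b n), ccos (a n)]) (jw s g r)%:E)%E @[n --> \oo] -->
    (\int[mu]_(r in `](- 1 : R)%R, 1%R[) (jw s g r)%:E)%E.
  rewrite BU; apply: ge0_nondecreasing_set_cvg_integral => //.
  - apply/nondecreasing_seqP => n; apply/subsetPset => x; rewrite /= !in_itv/=.
    move=> /andP[bx xa]; rewrite (le_trans _ bx) ?(le_trans xa)//.
      by rewrite ccos_le.
    by rewrite ccos_le// (lt_trans (a0 n)).
  - by move=> n; exact: measurable_funTS.
  - move=> n r; rewrite /= in_itv/= => /andP[br ra]; rewrite lee_fin.
    have ba : `[ccos (b n), ccos (a n)]%classic `<=` `]-1, (1 : R)[%classic.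
      by rewrite BU => z zn; exists n.
    have := ba r; rewrite /= !in_itv/= br ra => /(_ isT)/andP[r1 r2].
    by rewrite mulr_ge0 ?mulr_ge0 ?powR_ge0// g0// ler_norml !ltW.
apply: cvg_unique cvgA _ => //; apply: cvg_trans cvgB.
by apply: near_eq_cvg; near=> n; rewrite integral_jw_itv.
Unshelve. all: by end_near. Qed.

End CayleyIntegral.

(** * The algebra of trigonometric polynomials and parity *)

Section Trig.
Context {R : realType}.
Implicit Types (x s : R) (p q : {poly R}) (f g : R -> R).
Local Notation mu := (@lebesgue_measure R).

(* Trigonometric polynomials in theta, in the coordinate x = tan (theta / 2). *)
Definition trig f := exists p q, forall x, f x = p.[ccos x] + csin x * q.[ccos x].

Lemma trig_odd q : trig (fun x => csin x * q.[ccos x]).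
Proof. by exists 0, q => x; rewrite horner0 add0r. Qed.

Lemma trig_cst (c : R) : trig (fun=> c).
Proof. by exists c%:P, 0 => x; rewrite hornerC horner0 mulr0 addr0. Qed.

Lemma trigD f g : trig f -> trig g -> trig (fun x => f x + g x).
Proof.
move=> [p [q fE]] [p' [q' gE]]; exists (p + p'), (q + q') => x.
by rewrite fE gE !hornerD; ring.
Qed.

(** The product of two odd parts becomes even again through csin^2 = 1 - ccos^2. *)
Lemma trigM f g : trig f -> trig g -> trig (fun x => f x * g x).
Proof.
move=> [p [q fE]] [p' [q' gE]].
exists (p * p' + (1 - 'X ^+ 2) * (q * q')), (p * q' + q * p') => x.
rewrite fE gE -polyC1 !(hornerD, hornerM, hornerN, hornerC, hornerX, hornerXn).
rewrite -csin_sqr; ring.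
Qed.

Lemma trigZ (c : R) f : trig f -> trig (fun x => c * f x).
Proof. by move=> tf; apply: trigM => //; exact: trig_cst. Qed.

Lemma trigB f g : trig f -> trig g -> trig (fun x => f x - g x).
Proof.
move=> tf tg; rewrite (_ : (fun x => _) = (fun x => f x + (-1) * g x)).
  by apply: trigD => //; exact: trigZ.
by apply/funext => x; rewrite mulN1r.
Qed.

Lemma trig_continuous f : trig f -> continuous f.
Proof.
move=> [p [q fE]]; rewrite (funext fE) => x; apply: cvgD.
  exact: continuous_horner_ccos.
by apply: cvgM; [exact: continuous_csin|exact: continuous_horner_ccos].
Qed.

Lemma trig_measurable f : trig f -> measurable_fun [set: R] f.
Proof. by move=> tf; apply: continuous_measurable_fun; exact: trig_continuous. Qed.

Lemma trig_bounded f : trig f -> exists2 M, 0 < M & forall x, `|f x| <= M.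
Proof.
move=> [p [q fE]].
have [M M0 pM] := poly_bounded p; have [N N0 qN] := poly_bounded q.
(* The added 1 makes the bound strictly positive, so that a function can be rescaled by its
   inverse. *)
exists (M + N + 1) => [|x]; first by rewrite ltr_pwDr// addr_ge0.
rewrite fE (le_trans (ler_normD _ _))// -addrA lerD//.
  by rewrite pM// normr_ccos_le1.
rewrite normrM -[leLHS]addr0 lerD// -[N]mul1r ler_pM//.
  exact: normr_csin_le1.
by rewrite qN// normr_ccos_le1.
Qed.

Lemma trig_integrable s f : 2^-1 < s -> trig f ->
  mu.-integrable setT (fun x => (f x * wx s x)%:E).
Proof.
move=> hs tf; have [M _ fM] := trig_bounded _ tf.
by apply: (integrable_bounded_wx _ _ M) => //; exact: trig_measurable.
Qed.

(** On [-n, n] the reflection x -> -x shows that the integral equals its opposite. *)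
Lemma Rintegral_odd f : mu.-integrable setT (EFin \o f) -> continuous f ->
  (forall x, f (- x) = - f x) -> \int[mu]_x f x = 0.
Proof.
move=> intf cf fN; have h := cvg_Rintegral_symitv f intf.
apply: (@cvg_unique _ (@Rhausdorff R) _ _ _ _ h).
apply: cvg_near_cst; near=> n.
have := @integration_by_substitution_oppr R f (- n%:R) n%:R.
rewrite opprK => H.
have {}H : \int[mu]_(x in `[- n%:R, n%:R]) f x = \int[mu]_(x in `[- n%:R, n%:R]) - f x.
  rewrite /Rintegral H//; last exact: continuous_subspaceT.
    by congr fine; apply: eq_integral => x _ /=; rewrite fN.
  by rewrite -subr_ge0 opprK addr_ge0.
have fi : mu.-integrable `[- n%:R, (n%:R : R)] (EFin \o f).
  by apply: integrableS intf.
move: H; under [RHS]eq_Rintegral do rewrite -mulN1r.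
rewrite RintegralZl// mulN1r => /eqP.
by rewrite -addr_eq0 -mulr2n mulrn_eq0/= => /eqP.
Unshelve. all: by end_near. Qed.

(* The odd part csin * q.[ccos] does not contribute. *)
Lemma Rintegral_trig s f p q : 2^-1 < s ->
  (forall x, f x = p.[ccos x] + csin x * q.[ccos x]) ->
  \int[mu]_x (f x * wx s x) = cay_int s p.
Proof.
move=> hs fE.
under eq_Rintegral do rewrite fE mulrDl.
have i1 := integrable_horner_ccos s p hs.
have i2 := trig_integrable s _ hs (trig_odd q).
rewrite RintegralD// [X in _ + X]Rintegral_odd ?addr0//.
- move=> x; apply: cvgM; last exact: continuous_wx.
  exact: trig_continuous (trig_odd q) x.
- by move=> x; rewrite csinN ccosN wxN; ring.
Qed.

(** * Strict positivity of the integral *)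

Lemma poly_neq0_nonroot (g : {poly R}) : g != 0 ->
  exists2 r : R, -1 < r < 1 & g.[r] != 0.
Proof.
move=> g0; apply/not_exists2P => h.
(* The points 1/2, 1/3, ... lie in ]-1, 1[; taking [size g] of them gives one root more than the
   degree allows. *)
have roots : all (root g) [seq (i.+2%:R : R)^-1 | i <- iota 0 (size g)].
  apply/allP => _ /mapP[i _ ->]; apply/rootP.
  have [//|/eqP gi] := eqVneq g.[i.+2%:R^-1] 0.
  case: (h i.+2%:R^-1) => [|/negP]; last by rewrite negbK => /eqP.
  case; apply/andP; split; last by rewrite invf_lt1// ltr1n.
  by rewrite (lt_trans _ (_ : 0 < _)) ?invr_gt0// ltrN10.
have u : uniq [seq (i.+2%:R : R)^-1 | i <- iota 0 (size g)].
  rewrite map_inj_uniq ?iota_uniq// => i j /invr_inj/eqP.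
  by rewrite eqr_nat => /eqP[].
by have := max_poly_roots g0 roots u; rewrite size_map size_iota ltnn.
Qed.

(** By continuity the nonnegative integrand stays above half of a positive value on a short
    interval. *)
Lemma cay_int_gt0 s (g : {poly R}) : 2^-1 < s -> g != 0 ->
  (forall r : R, `|r| <= 1 -> 0 <= g.[r]) -> 0 < cay_int s g.
Proof.
move=> hs g0 gp; have [r r1 gr] := poly_neq0_nonroot _ g0.
have [x0 _ x0r] := ccos_onto _ r1.
pose f x := g.[ccos x] * wx s x.
have f0 x : 0 <= f x by rewrite mulr_ge0 ?gp ?normr_ccos_le1// ltW// wx_gt0.
have cf : continuous f.
  by move=> x; apply: cvgM; [exact: continuous_horner_ccos|exact: continuous_wx].
have fx0 : 0 < f x0.
  by rewrite lt_neqAle f0 andbT eq_sym mulf_neq0 ?x0r// lt0r_neq0 ?wx_gt0.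
have intf := integrable_horner_ccos s g hs.
have [d /= d0 fd] : exists2 d : R, 0 < d & forall x, `|x0 - x| < d -> f x0 / 2 < f x.
  have /cvgrPdist_lt/(_ (f x0 / 2)) := cf x0.
  rewrite divr_gt0// => /(_ isT)[d d0 fd]; exists d => // x xd.
  have := fd x xd; rewrite /= => /ltr_normlW; lra.
pose D := `[x0, x0 + d / 2]%classic.
have mD : measurable D by exact: measurable_itv.
have : \int[mu]_(x in D) (f x0 / 2) <= cay_int s g.
  rewrite /cay_int -/f; apply: (@le_trans _ _ (\int[mu]_(x in D) f x)).
    apply: le_Rintegral => //.
    - apply/integrableP; split; first exact: measurable_cst.
      rewrite integral_cst//= lebesgue_measure_itv/=.
      by case: ifP => _; rewrite ?mule0 ?ltry// -EFinB -EFinM ltry.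
    - exact: integrableS intf.
    - move=> x; rewrite /D/= in_itv/= => /andP[x0x xd].
      by rewrite ltW// fd// ler0_norm ?subr_le0// opprB; lra.
  apply: fine_le; [exact: integrable_fin_num (integrableS _ _ _ intf)|
    exact: integrable_fin_num|].
  apply: ge0_subset_integral => //; first exact: measurable_int intf.
  by move=> x _; rewrite lee_fin f0.
apply: lt_le_trans; rewrite Rintegral_cst//= lebesgue_measure_itv/= lte_fin.
by rewrite ltrDl divr_gt0//= mulr_gt0 ?divr_gt0// addrAC subrr add0r divr_gt0.
Qed.

(** * Norms and orthogonality of the two Jacobi families *)

(** Even and odd refer to parity in x: this family gives the real part of [Phi], the next one,
    multiplied by [csin], its imaginary part. *)
Definition even_jacobi s n : {poly R} := jacobi (- 2^-1) (s - 3 / 2) n.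
Definition odd_jacobi s n : {poly R} := jacobi 2^-1 (s - 2^-1) n.

(** At the infinities both sides are 0, by the convention for [fine]. *)
Let fine2M (X : \bar R) : fine (2%:E * X)%E = 2 * fine X.
Proof.
case: X => [r||]; first by rewrite -EFinM.
- by rewrite mulry (gtr0_sg (ltr0n _ 2)) mul1e [fine +oo]/fine mulr0.
- by rewrite mulrNy (gtr0_sg (ltr0n _ 2)) mul1e [fine -oo]/fine mulr0.
Qed.

Let jacobi_norm_sqr a b n :
  jacobi_norm a b n ^+ 2 = \int[mu]_(r in `[(-1 : R), 1])
    ((jacobi a b n).[r] ^+ 2 * ((1 - r) `^ a * (1 + r) `^ b)).
Proof.
rewrite /jacobi_norm sqr_sqrtr//; apply: Rintegral_ge0 => r _.
by rewrite mulr_ge0 ?sqr_ge0// mulr_ge0 ?powR_ge0.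
Qed.

Lemma even_jacobi_norm s n : 2^-1 < s ->
  cay_int s (even_jacobi s n * even_jacobi s n) =
  2 * jacobi_norm (- 2^-1) (s - 3 / 2) n ^+ 2.
Proof.
move=> hs; set P := even_jacobi s n.
have P0 (r : R) : `|r| <= 1 -> 0 <= (P * P).[r].
  by move=> _; rewrite hornerM -expr2 sqr_ge0.
rewrite /cay_int {1}/Rintegral (integral_jw s (P * P) P0) fine2M.
rewrite jacobi_norm_sqr; congr (_ * _); apply: eq_Rintegral => r _.
by rewrite hornerM -expr2.
Qed.

Lemma odd_jacobi_norm s n : 2^-1 < s ->
  cay_int s ((1 - 'X ^+ 2) * (odd_jacobi s n * odd_jacobi s n)) =
  2 * jacobi_norm 2^-1 (s - 2^-1) n ^+ 2.
Proof.
move=> hs; set P := odd_jacobi s n.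
have hE (r : R) : ((1 - 'X ^+ 2) * (P * P)).[r] = (1 - r) * (1 + r) * P.[r] ^+ 2.
  rewrite -polyC1 !(hornerD, hornerM, hornerN, hornerC, hornerX, hornerXn); ring.
have P0 (r : R) : `|r| <= 1 -> 0 <= ((1 - 'X ^+ 2) * (P * P)).[r].
  rewrite ler_norml hE => /andP[? ?]; rewrite mulr_ge0 ?sqr_ge0// mulr_ge0//; lra.
rewrite /cay_int {1}/Rintegral (integral_jw s _ P0) fine2M.
rewrite jacobi_norm_sqr; congr (_ * _); apply: eq_Rintegral => r.
rewrite inE/= in_itv/= hE => /andP[r1 r2].
(* At base 0, that is at r = 1 or r = -1, the rule relies on b being nonzero, since 0 to the power 0
   is 1. *)
have powRS (x a b : R) : b = a + 1 -> b != 0 -> 0 <= x -> x `^ b = x * x `^ a.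
  move=> -> a1; rewrite le_eqVlt => /predU1P[<-|x0].
    by rewrite mul0r powR0.
  by rewrite powRD ?(gt_eqF x0) ?implybT// powRr1 ?ltW// mulrC.
rewrite (powRS (1 - r) (- 2^-1) 2^-1); [|lra|by rewrite invr_eq0 pnatr_eq0|lra].
rewrite (powRS (1 + r) (s - 3 / 2) (s - 2^-1)); [|lra|by apply/lt0r_neq0; lra|lra].
by rewrite /P /odd_jacobi; ring.
Qed.

Lemma jacobi_neq0 (a b : R) n : -1 < a -> -1 < b -> jacobi a b n != 0.
Proof. by move=> a1 b1; rewrite -size_poly_eq0 size_jacobi. Qed.

(** A zero norm would contradict [cay_int_gt0] for the square of a nonzero polynomial. Hence
    [njacobi] really divides. *)
Lemma even_jacobi_norm_neq0 s n : 2^-1 < s ->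
  jacobi_norm (- 2^-1) (s - 3 / 2) n != 0.
Proof.
move=> hs; have := even_jacobi_norm s n hs; apply: contra_eqN => /eqP ->.
rewrite expr0n/= mulr0 gt_eqF// cay_int_gt0// => [|r _].
  by rewrite mulf_neq0// jacobi_neq0; lra.
by rewrite hornerM -expr2 sqr_ge0.
Qed.

Lemma odd_jacobi_norm_neq0 s n : 2^-1 < s ->
  jacobi_norm 2^-1 (s - 2^-1) n != 0.
Proof.
move=> hs; have := odd_jacobi_norm s n hs; apply: contra_eqN => /eqP ->.
rewrite expr0n/= mulr0 gt_eqF// cay_int_gt0// => [|r].
  rewrite mulf_neq0//; last by rewrite mulf_neq0// jacobi_neq0; lra.
  apply/eqP => /(congr1 (fun p : {poly R} => p.[0])).
  rewrite -polyC1 !(hornerD, hornerN, hornerC, hornerX, hornerXn).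
  by rewrite expr0n subr0 => /eqP; rewrite oner_eq0.
rewrite ler_norml => /andP[? ?].
rewrite !hornerM -expr2 mulr_ge0 ?sqr_ge0//.
rewrite -polyC1 !(hornerD, hornerN, hornerC, hornerX, hornerXn).
by rewrite (_ : _ - _ = (1 - r) * (1 + r)); [rewrite mulr_ge0//; lra|ring].
Qed.

Lemma even_jacobi_orthogonal s m n : 2^-1 < s -> m != n ->
  cay_int s (even_jacobi s m * even_jacobi s n) = 0.
Proof.
move=> hs; apply: (jacobi_orthogonal (- 2^-1) (s - 3 / 2) (cay_int s)); try lra.
- by move=> c p; exact: cay_intZ.
- by move=> p; exact: cay_int_jacobi_op.
Qed.

Lemma odd_jacobi_orthogonal s m n : 2^-1 < s -> m != n ->
  cay_int s ((1 - 'X ^+ 2) * (odd_jacobi s m * odd_jacobi s n)) = 0.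
Proof.
move=> hs; apply: (jacobi_orthogonal 2^-1 (s - 2^-1)
  (fun p => cay_int s ((1 - 'X ^+ 2) * p))); try lra.
- by move=> c p; rewrite -scalerAr; exact: cay_intZ.
(* Multiplication by 1 - X^2 intertwines the operators: [jacobi_op a b] of (1 - X^2) p is (1 - X^2)
   times the operator with parameters a + 1, b + 1 at p. *)
- move=> p; rewrite -(cay_int_jacobi_op _ ((1 - 'X ^+ 2) * p) hs); congr cay_int.
  rewrite /jacobi_op derivM derivB derivXn -polyC1 derivC polyC1.
  rewrite (_ : s - 2^-1 - 2^-1 = s - 1); last by field.
  rewrite (_ : s - 3 / 2 - - 2^-1 = s - 1); last by field.
  rewrite (_ : 2^-1 + (s - 2^-1) + 2 = s + 2); last by field.
  rewrite (_ : - 2^-1 + (s - 3 / 2) + 2 = s); last by field.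
  by rewrite [(s + 2)%:P]polyCD rmorph_nat; ring.
Qed.

End Trig.

(** * Orthonormality of the functions [Phi] *)

Section Orthonormal.
Context {R : realType}.
Implicit Types (x s : R) (w : R -> R) (f g : R -> R[i]).
Local Notation mu := (@lebesgue_measure R).

Lemma normc_sqr (z : R[i]) : normc z ^+ 2 = complex.Re z ^+ 2 + complex.Im z ^+ 2.
Proof. by case: z => a b; rewrite /normc sqr_sqrtr// addr_ge0 ?sqr_ge0. Qed.

Lemma L2norm_lty w f :
  (L2norm w f < +oo)%E <-> (\int[mu]_x (normc (f x) ^+ 2 * w x)%:E < +oo)%E.
Proof.
rewrite /L2norm; case: integral => [r||] //=; rewrite ?ltry//.
Qed.

Lemma L2norm_lt w f (e : R) : (forall x, 0 <= w x) -> 0 < e ->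
  (L2norm w f < e%:E)%E = (\int[mu]_x (normc (f x) ^+ 2 * w x)%:E < (e ^+ 2)%:E)%E.
Proof.
move=> w0 e0; rewrite /L2norm ltNge [RHS]ltNge; congr (~~ _).
have -> : e%:E = sqrte (e ^+ 2)%:E by rewrite /= sqrtr_sqr gtr0_norm.
rewrite lee_sqrt//; apply: integral_ge0 => x _.
by rewrite lee_fin mulr_ge0 ?sqr_ge0.
Qed.

Definition Phi_even s (k : int) : {poly R} :=
  (if k == 0 then (Num.sqrt 2)^-1 else 2^-1)
    / jacobi_norm (- 2^-1) (s - 3 / 2) `|k|%N *: even_jacobi s `|k|%N.

(* For k = 0 the sign of k kills the junk value of the predecessor. *)
Definition Phi_odd s (k : int) : {poly R} :=
  2^-1 * (sgz k)%:~R / jacobi_norm 2^-1 (s - 2^-1) `|k|%N.-1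
    *: odd_jacobi s `|k|%N.-1.

(** This form turns products of these functions into identities between polynomials in [ccos x],
    with [csin x] as the only odd factor. *)
Lemma Phi_ReIm s k x :
  Phi s k x = ((Phi_even s k).[ccos x] +i* (csin x * (Phi_odd s k).[ccos x]))%C.
Proof.
rewrite /Phi /Phi_even /Phi_odd /njacobi -/(ccos x).
case: eqVneq => [->|k0].
  apply/eqP; rewrite eq_complex/= !hornerZ sgz0.
  by apply/andP; split; apply/eqP; rewrite /even_jacobi; ring.
apply/eqP; rewrite eq_complex/= !hornerZ !(mul0r, mul1r, subr0, mulr0, addr0, add0r).
rewrite -/(even_jacobi s _) -/(odd_jacobi s _) /csin (addrC (x ^+ 2) 1).
apply/andP; split; apply/eqP; ring.
Qed.

(** For distinct |j| and |k| each family is orthogonal. For equal nonzero absolute values the even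
    part gives 1/2 and the odd part sgn j sgn k / 2, with sum 1 or 0. At index 0 the factor 1/sqrt 2
    makes the even part alone give 1. *)
Lemma Phi_even_mul s j k : 2^-1 < s ->
  cay_int s (Phi_even s j * Phi_even s k
    + (1 - 'X ^+ 2) * (Phi_odd s j * Phi_odd s k)) = (j == k)%:R.
Proof.
move=> hs.
have cD p q : cay_int s (p + q) = cay_int s p + cay_int s q.
  rewrite /cay_int -RintegralD//; [|exact: integrable_horner_ccos..].
  by apply: eq_Rintegral => x _; rewrite hornerD mulrDl.
have cZ c d p q r :
    cay_int s (r * ((c *: p) * (d *: q))) = c * d * cay_int s (r * (p * q)).
  by rewrite -cay_intZ// -!mul_polyC polyCM; congr cay_int; ring.
rewrite cD -[X in cay_int s X + _]mul1r !cZ mul1r.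
have ejo := even_jacobi_orthogonal s `|j|%N `|k|%N hs.
have ojo := odd_jacobi_orthogonal s `|j|%N.-1 `|k|%N.-1 hs.
have [jk|jk] := eqVneq `|j|%N `|k|%N; last first.
  rewrite [X in _ * X + _](ejo jk) [X in X + _]mulr0 add0r.
  have -> : (j == k) = false by apply: contra_neqF jk => /eqP ->.
  (* The predecessors of 0 and 1 coincide, so index 0 is set apart: its odd part is zero. *)
  have [->|j0] := eqVneq j 0; first by rewrite sgz0 mulr0 !mul0r.
  have [->|k0] := eqVneq k 0; first by rewrite sgz0 mulr0 mul0r mulr0 mul0r.
  rewrite ojo ?mulr0//; apply: contra_neq jk.
  by move: j0 k0; rewrite -!absz_gt0 => /prednK {2}<- /prednK {2}<- ->.
rewrite jk even_jacobi_norm// odd_jacobi_norm//.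
have N1 := even_jacobi_norm_neq0 s `|k|%N hs.
have N2 := odd_jacobi_norm_neq0 s `|k|%N.-1 hs.
move: (jacobi_norm _ _ _) (jacobi_norm _ _ _) N1 N2 => N N' N1 N2.
clear cD cZ ejo ojo.
have [j0|j0] := eqVneq j 0.
  have k0 : k = 0 by apply/eqP; rewrite -absz_eq0 -jk j0.
  rewrite j0 k0 eqxx sgz0 !mulr0 !mul0r addr0.
  have s2 : Num.sqrt (2 : R) != 0 by rewrite sqrtr_eq0 -ltNge.
  rewrite [LHS](_ : _ = 2 / Num.sqrt 2 ^+ 2); last by field; rewrite s2 N1.
  by rewrite sqr_sqrtr// divff// pnatr_eq0.
have k0 : k != 0 by rewrite -absz_eq0 -jk absz_eq0.
rewrite (negbTE k0).
rewrite [LHS](_ : _ = 2^-1 * (1 + (sgz j)%:~R * (sgz k)%:~R)); last first.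
  by field; rewrite N1 N2.
rewrite -intrM -sgzM.
have /orP[/eqP->|/eqP->] : (j == k) || (j == - k).
  by rewrite -eqr_norm2 -!abszE jk.
- rewrite eqxx gtr0_sgz ?mulVf ?pnatr_eq0//.
  by rewrite -expr2 exprn_even_gt0.
- rewrite mulNr sgzN gtr0_sgz ?subrr ?mulr0; last by rewrite -expr2 exprn_even_gt0.
  by rewrite eq_sym -addr_eq0 -mulr2n mulrn_eq0/= (negbTE k0).
Qed.
Lemma Phi_normc_sqr s k x : normc (Phi s k x) ^+ 2 =
  (Phi_even s k * Phi_even s k + (1 - 'X ^+ 2) * (Phi_odd s k * Phi_odd s k)).[ccos x].
Proof.
rewrite normc_sqr Phi_ReIm/= -polyC1.
rewrite !(hornerD, hornerM, hornerN, hornerC, hornerX, hornerXn) exprMn csin_sqr.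
by ring.
Qed.

Lemma Phi_in_L2 s k : 2^-1 < s -> in_L2 (wx s) (Phi s k).
Proof.
move=> hs; split; first split.
- rewrite (_ : (fun x => _) = fun x => (Phi_even s k).[ccos x]).
    exact: measurable_horner_ccos.
  by apply/funext => x; rewrite Phi_ReIm.
- rewrite (_ : (fun x => _) = fun x => csin x * (Phi_odd s k).[ccos x]).
    exact: (trig_measurable _ (trig_odd _)).
  by apply/funext => x; rewrite Phi_ReIm.
- apply/L2norm_lty; under eq_integral do rewrite Phi_normc_sqr.
  by apply: integrable_lty => //; exact: integrable_horner_ccos.
Qed.

(** The imaginary part of the integrand is [csin] times a polynomial in [ccos], hence odd with
    integral 0; the real part is the combination in [Phi_even_mul]. *)
Lemma inner_Phi s j k : 2^-1 < s -> inner (wx s) (Phi s j) (Phi s k) = (j == k)%:R.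
Proof.
move=> hs; rewrite /inner.
rewrite (@Rintegral_trig _ s _ (Phi_even s j * Phi_even s k
    + (1 - 'X ^+ 2) * (Phi_odd s j * Phi_odd s k)) 0 hs); last first.
  move=> x; rewrite !Phi_ReIm/= -polyC1 horner0 mulr0 addr0.
  rewrite !(hornerD, hornerM, hornerN, hornerC, hornerX, hornerXn) -csin_sqr.
  by ring.
rewrite Phi_even_mul//.
rewrite (@Rintegral_trig _ s _ 0
  (Phi_odd s j * Phi_even s k - Phi_even s j * Phi_odd s k) hs); last first.
  move=> x; rewrite !Phi_ReIm/= horner0 add0r.
  by rewrite !(hornerD, hornerM, hornerN); ring.
rewrite /cay_int; under eq_Rintegral do rewrite horner0 mul0r.
rewrite /Rintegral integral0.
by case: (j == k).
Qed.

Lemma orthonormal_Phi s : 2^-1 < s -> orthonormal_L2 (wx s) (Phi s).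
Proof. by move=> hs; split=> *; [exact: Phi_in_L2|exact: inner_Phi]. Qed.

End Orthonormal.

(** * The closure of the trigonometric polynomials in the real weighted L^2 *)

Section Density.
Context {R : realType}.
Implicit Types (x s : R) (f g h : R -> R).
Local Notation mu := (@lebesgue_measure R).

Definition sqint s f : \bar R := \int[mu]_x (f x ^+ 2 * wx s x)%:E.

Let sq_ge0 s f x : (0 <= (f x ^+ 2 * wx s x)%:E)%E.
Proof. by rewrite lee_fin mulr_ge0 ?sqr_ge0// ltW// wx_gt0. Qed.

Let measurable_sq s f : measurable_fun [set: R] f ->
  measurable_fun [set: R] (fun x => (f x ^+ 2 * wx s x)%:E).
Proof.
move=> mf; apply/measurable_EFinP/measurable_funM; last exact: measurable_wx.
exact: measurable_funX.
Qed.

(** From (f + g)^2 <= 2 f^2 + 2 g^2, which replaces the triangle inequality when squared norms are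
    used. *)
Lemma sqintD s f g : measurable_fun setT f -> measurable_fun setT g ->
  (sqint s (fun x => f x + g x)%R <= 2%:E * sqint s f + 2%:E * sqint s g)%E.
Proof.
move=> mf mg; rewrite /sqint.
have m2 h : measurable_fun [set: R] h ->
    measurable_fun [set: R] (fun x => 2%:E * (h x ^+ 2 * wx s x)%:E)%E.
  by move=> mh; apply: measurable_funeM; exact: measurable_sq.
have p2 h x : (0 <= 2%:E * (h x ^+ 2 * wx s x)%:E)%E by rewrite mule_ge0.
rewrite -!ge0_integralZl//; [|exact: measurable_sq..].
rewrite -ge0_integralD//; [|exact: m2..].
apply: ge0_le_integral => //.
- by move=> x _; exact: (sq_ge0 s (fun x => f x + g x)).
- by apply: (measurable_sq s (fun x => f x + g x)); exact: measurable_funD.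
- by apply: emeasurable_funD; exact: m2.
- move=> x _; rewrite -!EFinM -EFinD lee_fin.
  have := mulr_ge0 (sqr_ge0 (f x - g x)) (ltW (wx_gt0 s x)).
  by move: (wx s x) => w; lra.
Qed.

Lemma sqintZ s (c : R) f : measurable_fun setT f ->
  sqint s (fun x => c * f x) = ((c ^+ 2)%:E * sqint s f)%E.
Proof.
move=> mf; rewrite /sqint -ge0_integralZl ?lee_fin ?sqr_ge0//; last exact: measurable_sq.
by apply: eq_integral => x _; rewrite exprMn -mulrA EFinM.
Qed.

Definition trig_approx s f := forall e : R, 0 < e ->
  exists2 g, trig g & (sqint s (fun x => f x - g x)%R < e%:E)%E.

Lemma trig_approx_trig s f : trig f -> trig_approx s f.
Proof.
move=> tf e e0; exists f => //; rewrite /sqint.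
under eq_integral do rewrite subrr expr0n mul0r.
by rewrite integral0 lte_fin.
Qed.

Lemma trig_approxD s f g : measurable_fun setT f -> measurable_fun setT g ->
  trig_approx s f -> trig_approx s g -> trig_approx s (fun x => f x + g x).
Proof.
move=> mf mg af ag e e0; have e4 : 0 < e / 4 by rewrite divr_gt0.
have [f' tf' fe] := af _ e4; have [g' tg' ge] := ag _ e4.
exists (fun x => f' x + g' x); first exact: trigD.
rewrite (_ : (fun x => _) = (fun x => (f x - f' x) + (g x - g' x))); last first.
  by apply/funext => x; ring.
apply: le_lt_trans (sqintD _ _ _ _ _) _.
- by apply: measurable_funB => //; exact: trig_measurable.
- by apply: measurable_funB => //; exact: trig_measurable.
rewrite (_ : e%:E = 2%:E * (e / 4)%:E + 2%:E * (e / 4)%:E)%E; last first.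
  by rewrite -!EFinM -EFinD; congr (_%:E); field.
by rewrite lteD// lte_pmul2l.
Qed.

Lemma trig_approxZ s (c : R) f : measurable_fun setT f ->
  trig_approx s f -> trig_approx s (fun x => c * f x).
Proof.
move=> mf af e e0.
have c1 : 0 < c ^+ 2 + 1 by rewrite ltr_pwDr// sqr_ge0.
(* The added 1 covers c = 0. *)
have [f' tf' fe] := af (e / (c ^+ 2 + 1)) (divr_gt0 e0 c1).
exists (fun x => c * f' x); first exact: trigZ.
rewrite (_ : (fun x => _) = (fun x => c * (f x - f' x))); last first.
  by apply/funext => x; ring.
rewrite sqintZ; last by apply: measurable_funB => //; exact: trig_measurable.
apply: (@le_lt_trans _ _ ((c ^+ 2)%:E * (e / (c ^+ 2 + 1))%:E)%E).
  by rewrite lee_wpmul2l ?lee_fin ?sqr_ge0// ltW.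
rewrite -EFinM lte_fin mulrCA gtr_pMr// ltr_pdivrMr// mul1r.
by rewrite ltrDl.
Qed.

Lemma trig_approxB s f g : measurable_fun setT f -> measurable_fun setT g ->
  trig_approx s f -> trig_approx s g -> trig_approx s (fun x => f x - g x).
Proof.
move=> mf mg af ag; rewrite (_ : (fun x => _) = (fun x => f x + (-1) * g x)).
  apply: trig_approxD => //; last exact: trig_approxZ.
  by apply: measurable_funM => //; exact: measurable_cst.
by apply/funext => x; rewrite mulN1r.
Qed.

(** Dominated convergence brings some [f_ n] within squared distance e/4 of f, and a trigonometric
    polynomial comes equally close to that [f_ n]; by [sqintD] the total stays below e. *)
Lemma trig_approx_lim s (f_ : nat -> R -> R) f h :
  (forall n, measurable_fun setT (f_ n)) -> measurable_fun setT f ->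
  (forall n, trig_approx s (f_ n)) -> (forall x, f_ n x @[n --> \oo] --> f x) ->
  (forall n x, (f x - f_ n x) ^+ 2 <= h x) ->
  mu.-integrable setT (fun x => (h x * wx s x)%:E) -> trig_approx s f.
Proof.
move=> mf_ mf af_ f_f f_h inth e e0; have e4 : 0 < e / 4 by rewrite divr_gt0.
have mB n : measurable_fun [set: R] (fun x => f x - f_ n x) by exact: measurable_funB.
pose F n x := ((f x - f_ n x) ^+ 2 * wx s x)%:E.
have [|||||_ _] := @dominated_convergence _ _ _ mu _ measurableT F (cst 0%E)
  (fun x => (h x * wx s x)%:E).
- by move=> n; exact: measurable_sq.
- exact: measurable_cst.
- apply: aeW => x _; apply: cvg_EFin; first exact: nearW.
  have d0 : f x - f_ n x @[n --> \oo] --> 0.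
    by rewrite -(subrr (f x)); apply: cvgB; [exact: cvg_cst|exact: f_f].
  rewrite /= -[X in _ --> X](mul0r (wx s x)); apply: cvgM; last exact: cvg_cst.
  by have d2 := cvgM d0 d0; rewrite mulr0 in d2; exact: d2.
- exact: inth.
- apply: aeW => x n _; rewrite /F gee0_abs; last first.
    exact: (sq_ge0 s (fun x => f x - f_ n x)).
  by rewrite lee_fin (ler_wpM2r (ltW (wx_gt0 s x))).
rewrite integral0 => /fine_cvgP[finF /cvgrPdist_lt/(_ _ e4) cF].
have [n [finn]] : exists n, (\int[mu]_x F n x)%E \is a fin_num /\
    `|0 - fine (\int[mu]_x F n x)%E| < e / 4.
  by apply: (@filter_ex _ \oo); near=> n; split; near: n.
rewrite sub0r normrN => /ltr_normlW; rewrite -lte_fin fineK// => Fn.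
have [g tg ge] := af_ n _ e4; exists g => //.
rewrite (_ : (fun x => _) = (fun x => (f x - f_ n x) + (f_ n x - g x))); last first.
  by apply/funext => x; ring.
apply: le_lt_trans (sqintD _ _ _ _ _) _ => //.
  by apply: measurable_funB => //; exact: trig_measurable.
rewrite (_ : e%:E = 2%:E * (e / 4)%:E + 2%:E * (e / 4)%:E)%E; last first.
  by rewrite -!EFinM -EFinD; congr (_%:E); field.
by rewrite lteD// lte_pmul2l.
Unshelve. all: by end_near. Qed.

(** * Polynomial approximation of the sign, and indicators of open intervals *)

(** The Newton-Schulz iteration for the sign: 1 and -1 are attracting fixed points, and 0 is
    fixed. *)
Definition sgn_step (y : R) : R := (3 * y - y ^+ 3) / 2.

Let iter_sgn_step n (y : R) : R := iter n sgn_step y.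

Lemma iter_sgn_step_pos n (y : R) : 0 < y <= 1 ->
  y <= iter_sgn_step n y <= 1 /\ 1 - iter_sgn_step n y <= (1 - y / 2) ^+ n.
Proof.
move=> /andP[y0 y1]; rewrite /iter_sgn_step.
elim: n => [|n [/andP[yn n1] en]]; first by rewrite /= lexx y1 expr0; split=> //; lra.
rewrite /= exprS; set z := iter n _ _ in yn n1 en *.
(* 1 is an attracting fixed point: the error contracts by 1 - y / 2. *)
have zE : 1 - sgn_step z = (1 - z) * ((1 - z) * (2 + z) / 2).
  by rewrite /sgn_step; field.
have zE' : sgn_step z - z = z * ((1 - z) * (1 + z)) / 2.
  by rewrite /sgn_step; field.
have z0 : 0 <= z by lra.
have p0 : 0 <= (1 - z) * (2 + z) / 2 by rewrite divr_ge0// mulr_ge0//; lra.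
split.
  have h1 : 0 <= sgn_step z - z.
    by rewrite zE' divr_ge0// mulr_ge0// mulr_ge0//; lra.
  have h2 : 0 <= 1 - sgn_step z by rewrite zE mulr_ge0//; lra.
  by apply/andP; split; lra.
rewrite zE mulrC ler_pM//; first by lra.
(* The bound (1 - z) (2 + z) / 2 <= 1 - y / 2 amounts to y <= z + z^2. *)
have : 0 <= (z - y) + z * z by rewrite addr_ge0 ?mulr_ge0//; lra.
lra.
Qed.

Lemma iter_sgn_stepN n (y : R) : iter_sgn_step n (- y) = - iter_sgn_step n y.
Proof.
rewrite /iter_sgn_step; elim: n => //= n ->.
by rewrite /sgn_step exprNn -signr_odd/=; ring.
Qed.

Lemma cvg_iter_sgn_step_pos (y : R) : 0 < y <= 1 ->
  iter_sgn_step n y @[n --> \oo] --> (1 : R).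
Proof.
move=> y01; have /andP[y0 y1] := y01.
apply: (@squeeze_cvgr _ _ _ _ (fun n => 1 - (1 - y / 2) ^+ n) (fun=> 1)).
- by near=> n; have [/andP[_ ->]] := iter_sgn_step_pos n y y01; rewrite andbT; lra.
- rewrite -[X in _ --> X]subr0; apply: cvgB; first exact: cvg_cst.
  by apply: cvg_expr; rewrite ger0_norm; lra.
- exact: cvg_cst.
Unshelve. all: by end_near. Qed.

(** The map u -> (u + u^2) / 2 sends the possible limits 1, 0, -1 to 1, 0, 0, the indicator of
    positivity. *)
Definition pos_step n (y : R) : R := (iter_sgn_step n y + iter_sgn_step n y ^+ 2) / 2.

Lemma cvg_pos_step (y : R) : `|y| <= 1 -> pos_step n y @[n --> \oo] --> ((0 < y)%R%:R : R).
Proof.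
have cvg_sq (u : nat -> R) l : u n @[n --> \oo] --> l ->
    (u n + u n ^+ 2) / 2 @[n --> \oo] --> (l + l ^+ 2) / 2.
  move=> ul; apply: cvgM; last exact: cvg_cst.
  by apply: cvgD => //; exact: (cvgM ul ul).
rewrite ler_norml => /andP[yN1 y1].
have [y0|y0|<-] := ltgtP 0 y.
- have -> : (true%:R : R) = (1 + 1 ^+ 2) / 2 by rewrite /= expr1n; field.
  by apply: cvg_sq; apply: cvg_iter_sgn_step_pos; rewrite y0.
- have -> : (false%:R : R) = (- 1 + (- 1) ^+ 2) / 2 by rewrite /= sqrrN expr1n; field.
  apply: cvg_sq; rewrite -[y]opprK; under eq_cvg do rewrite iter_sgn_stepN.
  by apply: cvgN; apply: cvg_iter_sgn_step_pos; apply/andP; split; lra.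
- apply: cvg_near_cst; near=> n; rewrite /pos_step.
  suff -> : iter_sgn_step n 0 = 0 by rewrite expr0n/= addr0 mul0r.
  have := iter_sgn_stepN n 0; rewrite oppr0; lra.
Unshelve. all: by end_near. Qed.

Lemma normr_iter_sgn_step n (y : R) : `|y| <= 1 -> `|iter_sgn_step n y| <= 1.
Proof.
rewrite !ler_norml => /andP[yN1 y1].
have [y0|y0|<-] := ltgtP 0 y.
- by have [/andP[h1 h2] _] := iter_sgn_step_pos n y (introT andP (conj y0 y1));
    apply/andP; split; lra.
- have yp : 0 < - y <= 1 by apply/andP; split; lra.
  have [/andP[+ +] _] := iter_sgn_step_pos n _ yp; rewrite iter_sgn_stepN => h1 h2.
  by apply/andP; split; lra.
- have -> : iter_sgn_step n 0 = 0.
    by have := iter_sgn_stepN n 0; rewrite oppr0; lra.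
  by apply/andP; split; lra.
Qed.

Lemma trig_pos_step n f : trig f -> trig (fun x => pos_step n (f x)).
Proof.
move=> tf; have ti : trig (fun x => iter_sgn_step n (f x)).
  rewrite /iter_sgn_step; elim: n => [//|n IHn] /=.
  rewrite (_ : (fun x => _) = fun x => 2^-1 * (3 * iter n sgn_step (f x) -
    iter n sgn_step (f x) * (iter n sgn_step (f x) * iter n sgn_step (f x)))).
    apply: trigZ; apply: trigB; first exact: trigZ.
    by apply: trigM => //; exact: trigM.
  by apply/funext => x; rewrite /sgn_step; ring.
rewrite (_ : (fun x => _) = fun x => 2^-1 * (iter_sgn_step n (f x) +
    iter_sgn_step n (f x) * iter_sgn_step n (f x))).
  by apply: trigZ; apply: trigD => //; exact: trigM.
by apply/funext => x; rewrite /pos_step; ring.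
Qed.

Lemma trig_approx_itv s (a b : R) : 2^-1 < s -> trig_approx s (\1_(`]a, b[%classic)).
Proof.
move=> hs; have [ba|ab] := leP b a.
  rewrite set_itv_ge ?bnd_simp -?leNgt// indic0.
  exact/trig_approx_trig/trig_cst.
(* T is positive exactly on the interval. *)
pose T x : R := (x - a) * (b - x) / (1 + x ^+ 2).
have tT : trig T.
  (* Obtained by expanding (x - a) (b - x) and using x^2 / (1 + x^2) = (1 - ccos) / 2, 1 / (1 + x^2)
     = (1 + ccos) / 2 and x / (1 + x^2) = csin / 2. *)
  exists (2^-1 *: (- (1 - 'X) - (a * b) *: (1 + 'X))), ((a + b) / 2)%:P => x.
  rewrite -polyC1 !(hornerD, hornerN, hornerZ, hornerC, hornerX) /T /csin /ccos.
  by field; exact: onexsq_neq0.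
have [M M0 TM] := trig_bounded _ tT.
have tTM : trig (fun x => M^-1 * T x) by exact: trigZ.
have TM1 x : `|M^-1 * T x| <= 1.
  by rewrite normrM gtr0_norm ?invr_gt0// ler_pdivrMl// mulr1.
have T_itv x : (\1_(`]a, b[%classic) x : R) = (0 < M^-1 * T x)%R%:R.
  rewrite indicE mem_setE in_itv/= pmulr_rgt0 ?invr_gt0// /T pmulr_lgt0; last first.
    by rewrite invr_gt0 onexsq_gt0.
  congr (_%:R : R); congr nat_of_bool; apply/idP/idP => [/andP[xa xb]|].
    by rewrite mulr_gt0// subr_gt0.
  have [xa|xa] := ltP a x; first by rewrite pmulr_rgt0 ?subr_gt0.
  by rewrite ltNge mulr_le0_ge0//; lra.
(* The error never exceeds 2 in absolute value, hence the constant majorant 4 for its square. *)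
apply: (@trig_approx_lim s (fun n x => pos_step n (M^-1 * T x)) _ (fun=> 4)).
- by move=> n; exact: (trig_measurable _ (trig_pos_step n _ tTM)).
- exact: measurable_indic.
- by move=> n; apply: trig_approx_trig; exact: trig_pos_step.
- by move=> x; rewrite T_itv; exact: cvg_pos_step.
- move=> n x; have := normr_iter_sgn_step n _ (TM1 x).
  rewrite T_itv /pos_step; move: (iter_sgn_step _ _) => u u1.
  have u2 : u ^+ 2 <= 1 by rewrite -[u ^+ 2]real_normK ?num_real// expr_le1.
  have : `|(0 < M^-1 * T x)%R%:R - (u + u ^+ 2) / 2| <= 2.
    have u0 := sqr_ge0 u; move: u1; rewrite !ler_norml => /andP[? ?].
    by case: (0 < _) => /=; apply/andP; split; lra.
  move: (_ - _) => z z2; rewrite -(@real_normK _ z) ?num_real//.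
  rewrite (_ : 4 = 2 ^+ 2); last by ring.
  by rewrite lerXn2r ?nnegrE.
- by apply: (integrable_bounded_wx _ (fun=> 4) 4) => // x; rewrite ger0_norm.
Qed.

(** * From Borel sets to square integrable functions *)

Lemma integrable_cst_wx s (c : R) : 2^-1 < s ->
  mu.-integrable setT (fun x => (c * wx s x)%:E).
Proof. by move=> hs; apply: (integrable_bounded_wx _ (fun=> c) `|c|). Qed.

(** Open intervals are stable under intersection and generate the Borel sets. Approximability passes
    to proper differences by subtraction and to increasing unions by dominated convergence. *)
Lemma trig_approx_indic s (A : set R) : 2^-1 < s -> measurable A ->
  trig_approx s (\1_A).
Proof.
move=> hs mA.
suff : <<s @RGenOpens.G R >> `<=` [set A | measurable A /\ trig_approx s (\1_A)].
  have -> : <<s @RGenOpens.G R >> = (@measurable _ (measurableTypeR R)).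
    by rewrite [RHS]RGenOpens.measurableE.
  by move=> /(_ A mA)[].
apply: lambda_system_subset => //.
- move=> _ _ [a [b ->]] [c [d ->]].
  exists (Num.max a c), (Num.min b d); apply/seteqP; split => x /=.
    by rewrite !in_itv/= => -[/andP[ax xb] /andP[cx xd]]; rewrite gt_max lt_min ax cx xb.
  by rewrite !in_itv/= gt_max lt_min => /andP[/andP[-> ->] /andP[-> ->]].
- split => //.
  + split; first exact: measurableT.
    by rewrite indicT; exact/trig_approx_trig/trig_cst.
  + move=> B C CB [mB aB] [mC aC]; split; first exact: measurableD.
    rewrite (_ : \1_(B `\` C) = fun x => (\1_B x - \1_C x) : R).
      by apply: trig_approxB.
    apply/funext => x; rewrite !indicE in_setD.
    case: (boolP (x \in C)) => [xC|_]; last by rewrite andbT subr0.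
    by rewrite andbF (_ : x \in B) ?subrr//; apply/mem_set/CB/set_mem.
  + move=> F ndF GF; split; first by apply: bigcup_measurable => n _; have [] := GF n.
    have mF n : measurable (F n) by have [] := GF n.
    have mU : measurable (\bigcup_n F n) by exact: bigcup_measurable.
    apply: (@trig_approx_lim s (fun n => \1_(F n)) _ (fun=> 1)).
    - by move=> n; exact: measurable_indic.
    - exact: measurable_indic.
    - by move=> n; have [] := GF n.
    - move=> x; rewrite indicE; case: (boolP (x \in _)) => [/set_mem[n _ Fnx]|/negP xU].
        apply: cvg_near_cst; near=> m; rewrite indicE mem_set//.
        have /subsetPset : (F n <= F m)%O by apply: ndF; near: m; exact: nbhs_infty_ge.
        by apply.
      apply: cvg_near_cst; apply: nearW => m; rewrite indicE memNset// => Fmx.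
      by apply: xU; apply/mem_set; exists m.
    - move=> n x; rewrite !indicE.
      by do 2 case: (_ \in _) => /=; rewrite ?subrr ?subr0 ?sub0r ?sqrrN ?expr0n ?expr1n.
    - exact: integrable_cst_wx.
- move=> _ [a [b ->]]; split; first exact: measurable_itv.
  exact: trig_approx_itv.
Unshelve. all: by end_near. Qed.

Lemma trig_approx_sum s (I : Type) (r : seq I) (F : I -> R -> R) :
  (forall i, measurable_fun setT (F i)) -> (forall i, trig_approx s (F i)) ->
  trig_approx s (fun x => \sum_(i <- r) F i x).
Proof.
move=> mF aF; elim: r => [|i r IHr].
  rewrite (_ : (fun x => _) = fun=> 0); first exact/trig_approx_trig/trig_cst.
  by apply/funext => x; rewrite big_nil.
rewrite (_ : (fun x => _) = fun x => F i x + \sum_(i <- r) F i x).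
  by apply: trig_approxD => //; exact: measurable_sum.
by apply/funext => x; rewrite big_cons.
Qed.

(** Simple functions increase to f from below, so their squared error is dominated by the integrable
    f^2. *)
Lemma trig_approx_ge0 s f : 2^-1 < s -> measurable_fun setT f ->
  (forall x, 0 <= f x) -> mu.-integrable setT (fun x => (f x ^+ 2 * wx s x)%:E) ->
  trig_approx s f.
Proof.
move=> hs mf f0 f2.
have mEf : measurable_fun [set: R] (EFin \o f) by exact/measurable_EFinP.
pose F n := nnsfun_approx measurableT mEf n.
have Ef0 x : [set: R] x -> (0 <= (EFin \o f) x)%E by move=> _; rewrite lee_fin.
pose G (n : nat) (x : R) : R := F n x.
have GE n x : G n x = approx setT (EFin \o f) n x by rewrite /G /F nnsfun_approxE.
have Gf n x : G n x <= f x.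
  by rewrite GE -lee_fin; exact: (@le_approx _ _ _ _ (EFin \o f) n x Ef0).
have mG n : measurable_fun [set: R] (G n) by exact: measurable_funTS.
apply: (@trig_approx_lim s G f (fun x => f x ^+ 2)) => //.
- move=> n; have [r GrE] : exists r : seq R, forall x,
      G n x = \sum_(y <- r) (y * \1_(F n @^-1` [set y]) x).
    by eexists => x; rewrite /G fimfunE fsbig_finite.
  rewrite (funext GrE); apply: trig_approx_sum => y.
    by apply: measurable_funM => //; exact: measurable_indic.
  by apply: trig_approxZ; [exact: measurable_indic|exact: trig_approx_indic].
- move=> x; under eq_cvg do rewrite GE.
  by apply: (@cvg_approx _ _ _ setT (EFin \o f) x Ef0) => //; exact: ltry.
- move=> n x; rewrite lerXn2r ?nnegrE ?subr_ge0//.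
  by rewrite gerBl /G.
Qed.

(** The positive and negative parts are dominated by |f|, so each falls under the nonnegative
    case. *)
Lemma trig_approx_L2 s f : 2^-1 < s -> measurable_fun setT f ->
  mu.-integrable setT (fun x => (f x ^+ 2 * wx s x)%:E) -> trig_approx s f.
Proof.
move=> hs mf f2.
have mp : measurable_fun [set: R] (fun x => Num.max (f x) 0).
  by apply: measurable_maxr => //; exact: measurable_cst.
have mn : measurable_fun [set: R] (fun x => Num.max (- f x) 0).
  by apply: measurable_maxr => //; exact: measurable_funN.
rewrite (_ : f = fun x => Num.max (f x) 0 - Num.max (- f x) 0); last first.
  apply/funext => x; rewrite /Num.max.
  by have [?|?] := ltP (f x) 0; have [?|?] := ltP (- f x) 0; lra.
have le2 g : measurable_fun setT g -> (forall x, `|g x| <= `|f x|) ->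
    mu.-integrable setT (fun x => (g x ^+ 2 * wx s x)%:E).
  move=> mg gf; apply: le_integrable f2 => //; first exact: measurable_sq.
  move=> x _; rewrite /= lee_fin (normrM (g x ^+ 2)) (normrM (f x ^+ 2)).
  apply: ler_wpM2r => //.
  by rewrite !normrX lerXn2r ?nnegrE.
apply: trig_approxB => //; apply: trig_approx_ge0 => //.
- by move=> x; rewrite le_max lexx orbT.
- apply: le2 => // x; rewrite /Num.max; case: ltP => h; rewrite ?normr0//.
- by move=> x; rewrite le_max lexx orbT.
- apply: le2 => // x; rewrite /Num.max; case: ltP => h; rewrite ?normr0 ?normrN//.
Qed.

End Density.

(** * Completeness of the functions [Phi] *)

Section Completeness.
Context {R : realType}.
Implicit Types (x : R) (p q : {poly R}).
Local Notation mu := (@lebesgue_measure R).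
Local Open Scope complex_scope.

(** A family with one polynomial in each degree spans all polynomials: subtracting a multiple of the
    member of equal degree removes the leading term. *)
Lemma graded_poly_ind (b : nat -> {poly R}) (Q : {poly R} -> Prop) :
  (forall n, size (b n) = n.+1) -> Q 0 ->
  (forall c n p, Q p -> Q (p + c *: b n)) -> forall p, Q p.
Proof.
move=> sb Q0 QS p; have [n] := ubnP (size p).
elim: n p => [//|n IHn] p sp.
have [->//|p0] := eqVneq p 0.
have sp0 : (0 < size p)%N by rewrite size_poly_gt0.
pose m := (size p).-1.
have sm : size (b m) = size p by rewrite sb prednK.
have lb : lead_coef (b m) != 0 by rewrite lead_coef_eq0 -size_poly_gt0 sm.
pose c := lead_coef p / lead_coef (b m).
rewrite -(subrK (c *: b m) p); apply/QS/IHn.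
rewrite (leq_trans _ (_ : size p <= n)%N)//.
rewrite -(prednK sp0) ltnS; apply/leq_sizeP => j.
rewrite leq_eqVlt => /predU1P[<-|jm]; rewrite coefB coefZ.
  have -> : (b m)`_(size p).-1 = lead_coef (b m) by rewrite lead_coefE sm.
  by rewrite /c mulfVK// -lead_coefE subrr.
rewrite !nth_default ?mulr0 ?subrr// ?sm.
  by rewrite -(prednK sp0).
by rewrite -(prednK sp0).
Qed.

Context (s : R) (hs : 2^-1 < s).

(** Lists of pairs may repeat an index, so that sums are concatenations; [span_coef] merges the
    repetitions afterwards. *)
Let span (F : R -> R[i]) := exists l : seq (R[i] * int),
  forall x, F x = \sum_(z <- l) z.1 * Phi s z.2 x.

Let span_Phi k : span (Phi s k).
Proof. by exists [:: (1, k)] => x; rewrite big_seq1 mul1r. Qed.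

Let spanD F G : span F -> span G -> span (fun x => F x + G x).
Proof.
by move=> [l Fl] [l' Gl]; exists (l ++ l') => x; rewrite big_cat/= Fl Gl.
Qed.

Let spanZ c F : span F -> span (fun x => c * F x).
Proof.
move=> [l Fl]; exists [seq (c * z.1, z.2) | z <- l] => x.
by rewrite big_map Fl mulr_sumr; apply: eq_bigr => z _; rewrite mulrA.
Qed.

Let span_coef F : span F -> exists (K : seq int) (c : int -> R[i]),
  forall x, F x = \sum_(k <- K) c k * Phi s k x.
Proof.
move=> [l Fl]; exists (undup [seq z.2 | z <- l]),
  (fun k => \sum_(z <- l | z.2 == k) z.1) => x.
rewrite Fl; transitivity (\sum_(k <- undup [seq z.2 | z <- l])
    \sum_(z <- l | z.2 == k) z.1 * Phi s z.2 x); last first.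
  by apply: eq_bigr => k _; rewrite mulr_suml; apply: eq_bigr => z /eqP ->.
rewrite (exchange_big_dep predT)//=; apply: eq_big_seq => z zl.
rewrite -big_filter (eq_filter (a2 := pred1 z.2)); last by move=> k; rewrite /= eq_sym.
by rewrite filter_pred1_uniq ?undup_uniq ?mem_undup ?map_f// big_seq1.
Qed.

Let Phi_evenN k : Phi_even s (- k) = Phi_even s k.
Proof. by rewrite /Phi_even oppr_eq0 abszN. Qed.

Let Phi_oddN k : Phi_odd s (- k) = - Phi_odd s k.
Proof. by rewrite /Phi_odd abszN sgzN mulrNz mulrN mulNr scaleNr. Qed.

(** Opposite indices share the even part and have opposite odd parts, so the sum isolates the even
    one. At n = 0 both summands are the same function and the formula persists. *)
Let span_even_jacobi n : span (fun x => ((even_jacobi s n).[ccos x])%:C).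
Proof.
pose c := (if n%:Z == 0 then (Num.sqrt 2)^-1 else 2^-1)
    / jacobi_norm (- 2^-1) (s - 3 / 2) n.
have c0 : c != 0.
  rewrite mulf_neq0 ?invr_eq0 ?even_jacobi_norm_neq0//.
  by case: ifP => _; rewrite invr_eq0 ?pnatr_eq0// sqrtr_eq0 -ltNge.
have cE x : (Phi_even s n%:Z).[ccos x] = c * (even_jacobi s n).[ccos x].
  by rewrite /Phi_even absz_nat hornerZ.
rewrite (_ : (fun x => _) = fun x =>
    ((2 * c)^-1)%:C * (Phi s n%:Z x + Phi s (- n%:Z) x)).
  by apply: spanZ; apply: spanD; exact: span_Phi.
apply/funext => x; rewrite !Phi_ReIm Phi_evenN Phi_oddN hornerN cE.
by apply/eqP; rewrite eq_complex/=; apply/andP; split; apply/eqP; field.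
Qed.

(** The difference of the functions of index n + 1 and -(n + 1) is purely imaginary; the factor -i
    makes it real. *)
Let span_odd_jacobi n : span (fun x => (csin x * (odd_jacobi s n).[ccos x])%:C).
Proof.
pose c := 2^-1 / jacobi_norm 2^-1 (s - 2^-1) n.
have c0 : c != 0 by rewrite mulf_neq0 ?invr_eq0 ?odd_jacobi_norm_neq0// pnatr_eq0.
have cE x : (Phi_odd s n.+1%:Z).[ccos x] = c * (odd_jacobi s n).[ccos x].
  by rewrite /Phi_odd absz_nat gtr0_sgz// mulr1 hornerZ.
rewrite (_ : (fun x => _) = fun x =>
    ((2 * c)^-1)%:C * ((- 'i) * (Phi s n.+1%:Z x + (-1) * Phi s (- n.+1%:Z) x))).
  do 2 apply: spanZ; apply: spanD; first exact: span_Phi.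
  by apply: spanZ; exact: span_Phi.
apply/funext => x; rewrite !Phi_ReIm Phi_evenN Phi_oddN hornerN cE.
by apply/eqP; rewrite eq_complex/=; apply/andP; split; apply/eqP; field.
Qed.

Let span_trig f : trig f -> span (fun x => (f x)%:C).
Proof.
have spanE F G : F =1 G -> span F -> span G by move=> /funext ->.
have span0 : span (fun=> 0) by exists [::] => x; rewrite big_nil.
move=> [p [q fE]].
apply: (spanE (fun x => (p.[ccos x])%:C + (csin x * q.[ccos x])%:C)).
  by move=> x; rewrite fE rmorphD.
apply: spanD.
  apply: (@graded_poly_ind (even_jacobi s)
    (fun p => span (fun x => (p.[ccos x])%:C))).
  - by move=> n; apply: size_jacobi; move: hs; lra.
  - by apply: (spanE _ _ _ span0) => x; rewrite horner0.
  - move=> c n r sr; have sb := spanZ c%:C _ (span_even_jacobi n).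
  apply: (spanE _ _ _ (spanD _ _ sr sb)) => x.
    by rewrite hornerD hornerZ rmorphD rmorphM.
apply: (@graded_poly_ind (odd_jacobi s)
  (fun p => span (fun x => (csin x * p.[ccos x])%:C))).
- by move=> n; apply: size_jacobi; move: hs; lra.
- by apply: (spanE _ _ _ span0) => x; rewrite horner0 mulr0.
- move=> c n r sr; have sb := spanZ c%:C _ (span_odd_jacobi n).
  apply: (spanE _ _ _ (spanD _ _ sr sb)) => x.
  by rewrite hornerD hornerZ -rmorphM -rmorphD; congr (_%:C); ring.
Qed.

(** Real and imaginary parts are approximated separately, each within e^2 / 2 in squared norm, and
    the two approximants recombine in the complex span. *)
Lemma complete_Phi : complete_L2 (wx s) (Phi s).
Proof.
split=> [k|f [[mu_f mv_f] /L2norm_lty f2] e e0]; first exact: Phi_in_L2.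
have approx (g : R -> R) : measurable_fun setT g ->
    (forall x, g x ^+ 2 <= normc (f x) ^+ 2) -> trig_approx s g.
  move=> mg gf; apply: trig_approx_L2 => //.
  have mg2 (h : R -> R) : measurable_fun setT h ->
      measurable_fun [set: R] (fun x => (h x * wx s x)%:E).
    by move=> mh; apply/measurable_EFinP/measurable_funM => //; exact: measurable_wx.
  apply/integrableP; split; first by apply: mg2; exact: measurable_funX.
  apply: le_lt_trans f2; apply: ge0_le_integral => //.
  - by apply: measurableT_comp => //; apply: mg2; exact: measurable_funX.
  - apply: mg2; under eq_fun do rewrite normc_sqr.
    by apply: measurable_funD; exact: measurable_funX.
  - move=> x _; rewrite gee0_abs lee_fin; last first.
      exact: mulr_ge0 (sqr_ge0 _) (ltW (wx_gt0 _ _)).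
    exact: (ler_wpM2r (ltW (wx_gt0 s x))).
have e2 : 0 < e ^+ 2 / 2 by rewrite divr_gt0 ?exprn_gt0.
have [|g1 tg1 g1e] := approx _ mu_f _ _ e2.
  by move=> x; rewrite normc_sqr lerDl sqr_ge0.
have [|g2 tg2 g2e] := approx _ mv_f _ _ e2.
  by move=> x; rewrite normc_sqr lerDr sqr_ge0.
have [K [c cE]] :=
  span_coef _ (spanD _ _ (span_trig _ tg1) (spanZ 'i _ (span_trig _ tg2))).
exists K, c; rewrite L2norm_lt//; last by move=> x; exact/ltW/wx_gt0.
under eq_integral => x _.
  rewrite -cE normc_sqr.
  rewrite (_ : complex.Re _ = complex.Re (f x) - g1 x); last first.
    by case: (f x) => a b /=; ring.
  rewrite (_ : complex.Im _ = complex.Im (f x) - g2 x); last first.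
    by case: (f x) => a b /=; ring.
  rewrite mulrDl EFinD.
  over.
have mg (g h : R -> R) : measurable_fun setT g -> trig h ->
    measurable_fun [set: R] (fun x => ((g x - h x) ^+ 2 * wx s x)%:E).
  move=> mg th; apply/measurable_EFinP/measurable_funM; last exact: measurable_wx.
  by apply/measurable_funX/measurable_funB => //; exact: trig_measurable.
rewrite ge0_integralD//; [|
  by move=> x _; rewrite lee_fin; exact: mulr_ge0 (sqr_ge0 _) (ltW (wx_gt0 _ _))|
  exact: mg|
  by move=> x _; rewrite lee_fin; exact: mulr_ge0 (sqr_ge0 _) (ltW (wx_gt0 _ _))|
  exact: mg].
rewrite (_ : e ^+ 2 = e ^+ 2 / 2 + e ^+ 2 / 2); last by field.
by rewrite EFinD; apply: lteD.
Qed.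

End Completeness.

(** * Passage from the weighted to the unweighted space *)

Section Transfer.
Context {R : realType}.
Implicit Types (x s : R).
Local Notation mu := (@lebesgue_measure R).
Local Open Scope complex_scope.

(** The quotient of [phi] by [Phi]. Its squared modulus is the weight, so multiplication by it is an
    isometry onto the unweighted space. *)
Definition phi_factor s x : R[i] := (2 `^ (s / 2))%:C * xmi_powN s x.

Lemma normc_expi (t : R) : normc (expi t) = 1.
Proof. by rewrite /normc /expi cos2Dsin2 sqrtr1. Qed.

Lemma normc_real (a : R) : 0 <= a -> normc a%:C = a.
Proof. by move=> a0; rewrite /normc /= expr0n addr0 sqrtr_sqr ger0_norm. Qed.

Lemma normc_phi_factor s x : normc (phi_factor s x) = (1 + ccos x) `^ (s / 2).
Proof.
rewrite /phi_factor /xmi_powN !normcM normc_expi mulr1 !normc_real ?powR_ge0//.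
have c0 := onexsq_gt0 x.
rewrite ccosD1 powRM ?invr_ge0 ?(ltW c0)//; congr (_ * _).
by rewrite -(powR_inv1 (ltW c0)) -powRrM mulN1r.
Qed.

Lemma normc_phi_factor_sqr s x : normc (phi_factor s x) ^+ 2 = wx s x.
Proof.
rewrite normc_phi_factor wxE -powR_mulrn ?powR_ge0// -powRrM.
by rewrite mulfVK.
Qed.

Lemma phi_factor_conj s x : phi_factor s x * (phi_factor s x)^* = (wx s x)%:C.
Proof.
rewrite -normc_phi_factor_sqr normc_sqr; case: (phi_factor s x) => a b.
by apply/eqP; rewrite eq_complex/=; apply/andP; split; apply/eqP; ring.
Qed.

Lemma measurable_phi_factor s :
  measurable_fun [set: R] (fun x => complex.Re (phi_factor s x)) /\
  measurable_fun [set: R] (fun x => complex.Im (phi_factor s x)).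
Proof.
pose A x : R := 2 `^ (s / 2) * (1 + x ^+ 2) `^ (- (s / 2)).
pose th x : R := s / 2 * (pi - 2 * atan x).
have mA : measurable_fun [set: R] A.
  apply: measurable_funM => //.
  apply: (measurableT_comp (measurable_powR _)).
  by apply: measurable_funD => //; exact: measurable_funX.
have cth : continuous th.
  move=> x; apply: cvgM; first exact: cvg_cst.
  apply: cvgB; first exact: cvg_cst.
  by apply: cvgM; [exact: cvg_cst|exact: continuous_atan].
split.
- rewrite (_ : (fun x => _) = fun x => A x * cos (th x)).
    apply: measurable_funM => //; apply: continuous_measurable_fun => x.
    by apply: continuous_comp; [exact: cth|exact: continuous_cos].
  by apply/funext => x; rewrite /A /th /phi_factor /xmi_powN /expi/=; ring.
- rewrite (_ : (fun x => _) = fun x => A x * sin (th x)).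
    apply: measurable_funM => //; apply: continuous_measurable_fun => x.
    by apply: continuous_comp; [exact: cth|exact: continuous_sin].
  by apply/funext => x; rewrite /A /th /phi_factor /xmi_powN /expi/=; ring.
Qed.

Lemma cmeasurableM (f g : R -> R[i]) : cmeasurable f -> cmeasurable g ->
  cmeasurable (fun x => f x * g x).
Proof.
move=> [f1 f2] [g1 g2]; split.
- rewrite (_ : (fun x => _) = fun x => complex.Re (f x) * complex.Re (g x) -
      complex.Im (f x) * complex.Im (g x)).
    by apply: measurable_funB; exact: measurable_funM.
  by apply/funext => x; case: (f x) => a b; case: (g x).
- rewrite (_ : (fun x => _) = fun x => complex.Re (f x) * complex.Im (g x) +
      complex.Im (f x) * complex.Re (g x)).
    by apply: measurable_funD; exact: measurable_funM.
  by apply/funext => x; case: (f x) => a b; case: (g x).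
Qed.

Lemma L2norm_phi_factor s (g : R -> R[i]) :
  L2norm (fun=> 1) (fun x => phi_factor s x * g x) = L2norm (wx s) g.
Proof.
rewrite /L2norm; congr sqrte; apply: eq_integral => x _.
by rewrite normcM exprMn normc_phi_factor_sqr mulr1 mulrC.
Qed.

Lemma phi_in_L2 s k : 2^-1 < s -> in_L2 (fun=> 1) (phi s k).
Proof.
move=> hs; have [mP PL] := Phi_in_L2 s k hs; split.
  exact: (cmeasurableM (phi_factor s) _ (measurable_phi_factor s) mP).
by rewrite (_ : phi s k = fun x => phi_factor s x * Phi s k x)// L2norm_phi_factor.
Qed.

Lemma inner_phi s j k :
  inner (fun=> 1) (phi s j) (phi s k) = inner (wx s) (Phi s j) (Phi s k).
Proof.
have E x : phi s j x * (phi s k x)^* = (wx s x)%:C * (Phi s j x * (Phi s k x)^*).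
  rewrite /phi -/(phi_factor s x) rmorphM mulrACA; congr (_ * _).
  exact: phi_factor_conj.
rewrite /inner; congr (_ +i* _); apply: eq_Rintegral => x _; rewrite mulr1 E;
  case: (Phi s j x * _) => a b /=; ring.
Qed.

Lemma complete_phi s : 2^-1 < s -> complete_L2 (fun=> 1) (phi s).
Proof.
move=> hs; split=> [k|f [mf f2] e e0]; first exact: phi_in_L2.
(* This is f divided by [phi_factor s], the inverse being written as conjugate over squared
   modulus. *)
pose g x := ((wx s x)^-1)%:C * ((phi_factor s x)^* * f x).
have fE x : f x = phi_factor s x * g x.
  rewrite /g mulrCA (mulrA (phi_factor s x)) phi_factor_conj mulrA -rmorphM/=.
  by rewrite mulVf ?mul1r// lt0r_neq0// wx_gt0.
have mg : cmeasurable g.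
  apply: cmeasurableM.
    split; last exact: measurable_cst.
    rewrite (_ : (fun x => _) = fun x => (1 + ccos x) `^ (- s)).
      apply: (measurableT_comp (measurable_powR _)).
      apply: continuous_measurable_fun => x; apply: cvgD; first exact: cvg_cst.
      exact: continuous_ccos.
    by apply/funext => x; rewrite /= wxE powRN.
  apply: cmeasurableM => //; have [m1 m2] := measurable_phi_factor s; split.
    by apply: eq_measurable_fun m1 => x _; case: phi_factor.
  by apply: eq_measurable_fun (measurable_funN m2) => x _ /=; case: (phi_factor s x).
have fgE : f = fun x => phi_factor s x * g x by apply/funext.
have gL : in_L2 (wx s) g by split=> //; rewrite -L2norm_phi_factor -fgE.
have [_ /(_ g gL e e0)[K [c h]]] := complete_Phi s hs.
exists K, c; rewrite -L2norm_phi_factor in h.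
rewrite (_ : (fun x => _) =
  fun x => phi_factor s x * (g x - \sum_(k <- K) c k * Phi s k x))//.
apply/funext => x; rewrite fE mulrBr mulr_sumr; congr (_ - _).
by apply: eq_bigr => k _; rewrite /phi -/(phi_factor s x) mulrCA.
Qed.

(** * Decay at infinity *)

Lemma normc_real_cpow (x t : R) : normc (real_cpow x t) = `|x| `^ t.
Proof. by rewrite /real_cpow normcM normc_expi mulr1 normc_real// powR_ge0. Qed.

Lemma ccosD1_cvgy0 : 1 + ccos x @[x --> +oo%R] --> (0 : R).
Proof.
apply: (@squeeze_cvgr _ _ _ _ (fun=> 0) (fun x => 4 `^ 1 * (1 + x) `^ (- (2 * 1)))).
- near=> x; have x0 : 0 <= x by near: x; exact: nbhs_pinfty_ge.
  (* 1 + [ccos x] is the weight for s = 1, so [wx_le] bounds it. *)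
  rewrite ltW ?ccosD1_gt0//= -[leLHS](powRr1 (ltW (ccosD1_gt0 x))) -wxE.
  exact: wx_le.
- exact: cvg_cst.
- rewrite -[X in _ --> X](mulr0 (4 `^ 1)).
  by apply: cvgM; [exact: cvg_cst|apply: powR_cvgy0; rewrite mulr1].
Unshelve. all: by end_near. Qed.

Lemma ccos_cvgy : ccos x @[x --> +oo%R] --> (- 1 : R).
Proof.
rewrite (_ : ccos = fun x : R => (1 + ccos x) - 1); last by apply/funext => x; ring.
rewrite -[X in _ --> X]add0r.
by apply: cvgB; [exact: ccosD1_cvgy0|exact: cvg_cst].
Qed.

Lemma powR_sub_cvgy (t s : R) : t <= s ->
  x `^ (t - s) @[x --> +oo%R] --> ((t == s)%:R : R).
Proof.
rewrite le_eqVlt => /predU1P[->|ts].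
  rewrite subrr eqxx; apply: cvg_near_cst; near=> x; exact: powRr0.
rewrite (lt_eqF ts) -opprB.
(* The shift by 1 matches the base 1 + x of [powR_cvgy0]. *)
have h : x - 1 @[x --> +oo%R] --> (+oo%R : set_system R).
  apply/cvgryPgt => A; near=> x; rewrite ltrBrDr; near: x.
  exact: (nbhs_pinfty_gt (num_real _)).
have st : 0 < s - t by rewrite subr_gt0.
have := cvg_comp _ _ h (powR_cvgy0 _ st).
by apply: cvg_trans; apply: near_eq_cvg; near=> x; rewrite /= addrC subrK.
Unshelve. all: by end_near. Qed.

(** For x > 0, x^2 (1 + ccos x) = 1 - ccos x turns x^t (1 + ccos x)^(s/2) into x^(t - s) (1 - ccos
    x)^(s/2), whose second factor tends to 2^(s/2). The modulus is even in x, so both ends have the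
    same limit, which is 0 when t < s. *)
Lemma phi_decay s k (t : R) : t <= s -> exists l : R,
  normc (real_cpow x t * phi s k x) @[x --> +oo] --> l /\
  normc (real_cpow x t * phi s k x) @[x --> -oo] --> l.
Proof.
move=> ts.
(* [Q] at [ccos x] is the squared modulus of [Phi s k x], and [ccos] tends to -1. *)
pose Q : {poly R} := Phi_even s k * Phi_even s k
  + (1 - 'X ^+ 2) * (Phi_odd s k * Phi_odd s k).
pose F x := `|x| `^ t * ((1 + ccos x) `^ (s / 2) * Num.sqrt Q.[ccos x]).
have FE x : normc (real_cpow x t * phi s k x) = F x.
  rewrite normcM normc_real_cpow /phi -/(phi_factor s x) normcM normc_phi_factor.
  have n0 : 0 <= normc (Phi s k x) by case: (Phi s k x) => a b; exact: sqrtr_ge0.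
  by rewrite /F /Q -Phi_normc_sqr sqrtr_sqr (ger0_norm n0).
have cvg_cont (h u : R -> R) a : {for a, continuous h} ->
    u x @[x --> +oo%R] --> a -> h (u x) @[x --> +oo%R] --> h a.
  by move=> ch ua; exact: (cvg_comp _ _ ua ch).
have cvgF : F x @[x --> +oo%R] --> (t == s)%:R * (2 `^ (s / 2) * Num.sqrt Q.[-1]).
  have h1 : (1 - ccos x) `^ (s / 2) @[x --> +oo%R] --> 2 `^ (s / 2).
    apply: (cvg_cont (fun y : R => y `^ (s / 2))).
      have [d _] := is_derive1_powR (s / 2) (ltr0n R 2).
      exact/differentiable_continuous/derivable1_diffP.
    rewrite (_ : 2 = 1 - (- 1) :> R); last by ring.
    by apply: cvgB; [exact: cvg_cst|exact: ccos_cvgy].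
  have h2 : Num.sqrt Q.[ccos x] @[x --> +oo%R] --> Num.sqrt Q.[-1].
    apply: (cvg_cont (fun y : R => Num.sqrt y) (fun x => Q.[ccos x])).
      exact: sqrt_continuous.
    apply: (cvg_cont (fun y : R => Q.[y])).
      exact: continuous_horner.
    exact: ccos_cvgy.
  apply: cvg_trans (cvgM (powR_sub_cvgy _ _ ts) (cvgM h1 h2)).
  apply: near_eq_cvg; near=> x.
  have x0 : 0 < x by near: x; exact: nbhs_pinfty_gt.
  rewrite /F gtr0_norm//= !mulrA; congr (_ * _).
  rewrite ccosB1 -ccosD1 powRM ?sqr_ge0 ?(ltW (ccosD1_gt0 _))//.
  rewrite -powR_mulrn ?(ltW x0)// -powRrM (mulrC 2%:R) mulfVK//.
  rewrite mulrA -powRD ?subrK//.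
  by rewrite (gt_eqF x0) implybT.
exists ((t == s)%:R * (2 `^ (s / 2) * Num.sqrt Q.[-1])).
under eq_cvg do rewrite FE.
split=> //; apply/cvgNy_compNP.
rewrite (_ : _ \o _ = F)//; apply/funext => x.
by rewrite /= FE /F normrN ccosN.
Unshelve. all: by end_near. Qed.

End Transfer.

Theorem proposition1 (R : realType) (s : R) (hs : 2^-1 < s) :
  [/\ complete_L2 (wx s) (Phi s) /\ orthonormal_L2 (wx s) (Phi s),
      complete_L2 (fun=> 1) (phi s) /\ orthonormal_L2 (fun=> 1) (phi s)
    & forall (k : int) (t : R), t <= s ->
        exists l : R,
          normc (real_cpow x t * phi s k x) @[x --> +oo] --> l /\
          normc (real_cpow x t * phi s k x) @[x --> -oo] --> l].
Proof.
split.
- by split; [exact: complete_Phi|exact: orthonormal_Phi].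
- split; first exact: complete_phi.
  split=> [k|j k]; first exact: phi_in_L2.
  by rewrite inner_phi inner_Phi.
- by move=> k t; exact: phi_decay.
Qed.
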